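(* Let $K$ be a convex body in $\mathbb{R}^d$ with $o\in\mathrm{int}(K)$, and let $\mu$ be the uniform probability measure (normalized Lebesgue measure) on $K$. Then for every $0<t<\sqrt2$, \[F(t):=\mu\otimes\mu\{(x,y)\in K\times K:\|x-y\|_K\le t\}\le\left(\frac{t^2(4-t^2)}{4}\right)^{d/2}.\]
   Context: A convex body is a compact convex set with non-empty interior. $\|x\|_K=\inf\{\lambda>0:x\in\lambda K\}$ (a possibly asymmetric norm). *)

(* Defs.v *)
From HB Require Import structures.
From mathcomp Require Import all_boot all_order all_algebra.
From mathcomp Require Import all_classical all_reals all_analysis.
Set Implicit Arguments. Unset Strict Implicit. Unset Printing Implicit Defensive.
Import Order.TTheory GRing.Theory Num.Theory.
Import numFieldNormedType.Exports.
Local Open Scope classical_set_scope.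
Local Open Scope ring_scope.

Definition borelRd (R : realType) (d : nat) : Type :=
  g_sigma_algebraType (@open 'rV[R]_d).

Definition convex_body (R : realType) (d : nat) (K : set 'rV[R]_d) : Prop :=
  [/\ compact K, convex_set K & K° !=set0].

Definition gauge (R : realType) (d : nat) (K : set 'rV[R]_d) (x : 'rV[R]_d) : R :=
  inf [set l : R | 0 < l /\ exists2 k, K k & x = l *: k].

(* lam is the Lebesgue measure on the Borel sets of R^d: it gives every
   closed box prod_i [a_i, b_i] its volume. (This determines lam uniquely.) *)
Definition is_lebesgue_measure (R : realType) (d : nat)
    (lam : set (borelRd R d) -> \bar R) : Prop :=
  forall a b : 'rV[R]_d, (forall i, a ord0 i <= b ord0 i) ->
    lam [set x : borelRd R d | forall i, a ord0 i <= (x : 'rV[R]_d) ord0 i <= b ord0 i]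
    = (\prod_(i < d) (b ord0 i - a ord0 i))%:E.

Definition uniform_on (R : realType) (d : nat)
    (lam : set (borelRd R d) -> \bar R) (K : set 'rV[R]_d) :
    set (borelRd R d) -> \bar R :=
  fun A => (lam (A `&` K) / lam K)%E.

Definition Fdist (R : realType) (d : nat)
    (lam : set (borelRd R d) -> \bar R) (K : set 'rV[R]_d) (t : R) : \bar R :=
  ((uniform_on lam K) \x (uniform_on lam K))%E
    [set p : borelRd R d * borelRd R d |
       [/\ K p.1, K p.2 & gauge K ((p.1 : 'rV[R]_d) - p.2) <= t]].

(* Main.v *)
Require Import Defs.
From HB Require Import structures.
From mathcomp Require Import all_boot all_order all_algebra.
From mathcomp Require Import all_classical all_reals all_analysis.
From mathcomp Require Import measurable_realfun ring lra.
Set Implicit Arguments. Unset Strict Implicit. Unset Printing Implicit Defensive.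
Import Order.TTheory GRing.Theory Num.Theory.
Import numFieldNormedType.Exports.
Local Open Scope classical_set_scope.
Local Open Scope ring_scope.

(** Put s = t^2 / (4 - t^2), a = (1 + s) / 2 and c = 2 - 2 a. The volume of
  {(x, y) in K x K : x - y in t K} is the integral of 1_K(x)^a 1_K(y)^a 1_(tK)(x - y)^c,
  so the sharp Young inequality bounds it by C^d |K|^a |K|^a |tK|^c, and this
  choice of a, which minimizes the bound, gives (C t^c)^2 = t^2 (4 - t^2) / 4.

  In dimension one the sharp Young inequality is proved by transport (Barthe):
  let X, Y push the weight exp(-p^2) to f and g, and substitute x = X p,
  y = Y q. By AM-GM (X' Y')^(1-a) <= ((X' + Y') / 2)^c. Along a line
  p + q = sigma the factor h(X - Y) (X' + Y') is the derivative of a primitive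
  of h composed with X - Y, while exp(-p^2) exp(-q^2) is a Gaussian in p times
  a Gaussian in sigma, so a weighted AM-GM (pointwise Hoelder) bounds the
  integral. Higher dimensions follow by integrating one coordinate at a time;
  positive Lipschitz functions on cubes form a class stable under marginals,
  and they approximate the indicators from above. *)

(** * One-dimensional transport *)

(** The weight is Gaussian because Gaussians are the extremizers of the sharp Young inequality; both
    maps use the same one because f and g carry the same exponent. The exponents satisfy a + a + c =
    2, the scaling condition of Young's inequality, which makes |K| cancel in the end. The range 1/2
    < a < 1 is 0 < s < 1, and its upper half is the hypothesis t < sqrt 2. The obstacle is to keep
    the constant sharp with elementary calculus. The transports run between compact intervals, so
    the Gaussian is cut at [-N, N]; this costs a factor, the truncated mass m in place of sqrt pi,
    which disappears as N grows. Functions bounded below by some e > 0 give C^1 maps on the whole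
    line with positive derivative, so indicators enter only as limits of such functions. Differences
    of points of [-M, M] fill [-2M, 2M], hence the doubled cube for h throughout. The
    one-dimensional constant is multiplied once per coordinate, so the bound in dimension d is its
    exact d-th power, and every Gaussian integral is kept in closed form until the factors pi
    cancel. *)

Lemma within_continuousT {R : realType} (A : set R) (f : R -> R) :
  continuous f -> {within A, continuous f}.
Proof. by move=> cf; apply: continuous_subspaceT => x; exact: cf. Qed.

Lemma continuous_integrable_itv {R : realType} (f : R -> R) a b :
  continuous f -> (@lebesgue_measure R).-integrable `[a, b] (EFin \o f).
Proof.
move=> cf; apply: continuous_compact_integrable; first exact: segment_compact.
exact: within_continuousT.
Qed.

Lemma is_derive_continuous {R : realType} (f df : R -> R) :
  (forall x : R, is_derive x (1 : R) f (df x)) -> continuous f.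
Proof.
move=> fd x; apply: differentiable_continuous; apply/derivable1_diffP.
by case: (fd x).
Qed.

Lemma primitive_exists {R : realType} (f : R -> R) : continuous f ->
  exists F : R -> R, forall x : R, is_derive x (1 : R) F (f x).
Proof.
move=> cf.
pose I (a x : R) := (\int[lebesgue_measure]_(t in `[a, x]) f t)%R.
have If (a x : R) : a < x -> is_derive x (1 : R) (I a) (f x).
  move=> ax; have [|||//|d e] := @continuous_FTC1_closed R f a x (x + 1).
  - by rewrite ltrDl.
  - exact: continuous_integrable_itv.
  - exact: ax.
  - exact: cf.
  by apply: DeriveDef; [exact: d|rewrite -derive1E; exact: e].
(* The signed integral from 0 to [x]. Near [x] it differs by a constant from the integral started at
   any [a] to the left of both 0 and [x], where the fundamental theorem for [a < x] applies. *)
pose F (x : R) := (\int[lebesgue_measure]_(t in `]0, x]) f t) - (\int[lebesgue_measure]_(t in `]x, 0]) f t).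
have FE (a x : R) : a < 0 -> a < x -> F x = I a x - I a 0.
  move=> a0 ax; rewrite /F; have [x0|x0] := leP 0 x.
    have -> : \int[lebesgue_measure]_(t in `]x, 0]) f t = 0.
      by rewrite set_itv_ge ?Rintegral_set0// bnd_simp -leNgt.
    rewrite subr0 -(@Rintegral_itvB _ f (BLeft a) (BRight x) 0) ?bnd_simp//; try exact: ltW.
    exact: continuous_integrable_itv.
  have -> : \int[lebesgue_measure]_(t in `]0, x]) f t = 0.
    by rewrite set_itv_ge ?Rintegral_set0// bnd_simp -leNgt ltW.
  rewrite sub0r -(@Rintegral_itvB _ f (BLeft a) (BRight 0) x) ?bnd_simp ?opprB//; try exact: ltW.
  exact: continuous_integrable_itv.
exists F => x.
pose a := Num.min x 0 - 1.
have a0 : a < 0 by rewrite /a ltrBlDr add0r gt_min ltr01 orbT.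
have ax : a < x by rewrite /a ltrBlDr gt_min ltrDl ltr01.
have d1 : is_derive x (1 : R) (I a - cst (I a 0)) (f x - 0).
  by apply: is_deriveB; apply: If.
rewrite subr0 in d1.
apply: (near_eq_is_derive _ d1).
near=> y; rewrite (FE a)//; near: y; exact: lt_nbhsr.
Unshelve. all: by end_near. Qed.

Lemma FTC2_continuous {R : realType} (f F : R -> R) (a b : R) : a <= b ->
  continuous f -> (forall x : R, is_derive x (1 : R) F (f x)) ->
  \int[lebesgue_measure]_(x in `[a, b]) f x = F b - F a.
Proof.
rewrite le_eqVlt => /predU1P[<- _ _|ab cf Ff].
  by rewrite set_itv1 Rintegral_set1 subrr.
have cF := is_derive_continuous Ff.
rewrite /Rintegral (continuous_FTC2 ab (F := F))//.
- exact: within_continuousT.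
- split.
  + by move=> x _; case: (Ff x).
  + by apply: cvg_at_right_filter; exact: cF.
  + by apply: cvg_at_left_filter; exact: cF.
- by move=> x _; rewrite derive1E; case: (Ff x).
Qed.

Lemma integral_substitution {R : realType} (X dX G : R -> R) (a b : R) :
  a <= b -> (forall p : R, is_derive p (1 : R) X (dX p)) -> continuous dX ->
  (forall p, 0 < dX p) -> continuous G ->
  (\int[lebesgue_measure]_(x in `[X a, X b]) (G x)%:E =
   \int[lebesgue_measure]_(p in `[a, b]) (G (X p) * dX p)%:E)%E.
Proof.
move=> ab Xd cdX dX0 cG.
have cX := is_derive_continuous Xd.
have dXE : (X^`())%classic = dX by apply/funext => p; rewrite derive1E; case: (Xd p).
rewrite (@integration_by_substitution_increasing R X G a b)//.
- by apply: eq_integral => x _; rewrite dXE.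
- move=> x y _ _ xy; have [|z _ /eqP] := @MVT R X dX x y xy.
    exact: within_continuousT.
  by rewrite subr_eq => /eqP ->; rewrite ltrDr mulr_gt0// subr_gt0.
- by rewrite dXE => x _; exact: cdX.
- by rewrite dXE; apply/cvg_ex; exists (dX a); apply: cvg_at_right_filter; exact: cdX.
- by rewrite dXE; apply/cvg_ex; exists (dX b); apply: cvg_at_left_filter; exact: cdX.
- split.
  + by move=> x _; case: (Xd x).
  + by apply: cvg_at_right_filter; exact: cX.
  + by apply: cvg_at_left_filter; exact: cX.
- exact: within_continuousT.
Qed.

(* [X] transports [k * g] on [u, v] to [f] on [a, b]: the lower bound on [f]
   makes its primitive a bijection of the line, so [X] is defined and C^1 globally. *)
Lemma transport_exists {R : realType} (f g : R -> R) (e a b u v : R) :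
  0 < e -> (forall x, e <= f x) -> continuous f ->
  continuous g -> (forall x, 0 < g x) -> a <= b -> u < v ->
  let k := (\int[lebesgue_measure]_(x in `[a, b]) f x) /
           (\int[lebesgue_measure]_(x in `[u, v]) g x) in
  exists X : R -> R, [/\ X u = a, X v = b &
    forall p : R, is_derive p (1 : R) X (k * g p / f (X p))].
Proof.
move=> e0 fe cf cg g0 ab uv k.
have [F Ff] := primitive_exists cf.
have [G Gg] := primitive_exists cg.
have cF := is_derive_continuous Ff.
have cG := is_derive_continuous Gg.
have f0 x : 0 < f x by exact: lt_le_trans (fe x).
have Fe x y : x <= y -> e * (y - x) <= F y - F x.
  move=> xy; have [|z _ ->] := @MVT_segment R F f x y xy.
    exact: within_continuousT.
  by rewrite ler_wpM2r// subr_ge0.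
have Finj : injective F.
  move=> x y Fxy; apply/eqP; rewrite eq_le.
  by apply/andP; split; rewrite leNgt; apply/negP => xy;
    have := Fe _ _ (ltW xy); rewrite Fxy subrr leNgt mulr_gt0// subr_gt0.
have Fsurj y : exists x, F x = y.
  (* [F] grows with slope at least [e], so [F (- d)] and [F d] enclose [y]. *)
  pose d := `|y - F 0| / e.
  have d0 : 0 <= d by rewrite divr_ge0// ltW.
  have h1 := Fe _ _ d0; have h2 := Fe (- d) 0; rewrite oppr_le0 in h2.
  have {}h2 := h2 d0.
  have ed : e * d = `|y - F 0| by rewrite /d mulrCA divff ?mulr1// gt_eqF.
  rewrite subr0 ed in h1; rewrite sub0r opprK ed in h2.
  have n1 := ler_norm (y - F 0); have n2 := ler_norm (- (y - F 0)); rewrite normrN in n2.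
  have [] := @IVT R F (- d) d y.
  - by rewrite (le_trans _ d0)// oppr_le0.
  - exact: within_continuousT.
  - rewrite ge_min le_max; apply/andP; split; apply/orP; [left|right].
    + lra.
    + lra.
  - by move=> x _ <-; exists x.
pose Q y := projT1 (cid (Fsurj y)).
have FQ y : F (Q y) = y by rewrite /Q; case: cid.
have QF x : Q (F x) = x by apply: Finj; rewrite FQ.
have Qd y : is_derive y (1 : R) Q (f (Q y))^-1.
  rewrite -{1}(FQ y); apply: (@is_derive_inverse _ F); last by rewrite gt_eqF.
  - by near=> z; exact: QF.
  - by near=> z; exact: cF.
(* The map that matches accumulated masses: [F (X p) - F a = k * (G p - G u)]. Differentiation gives
   [f (X p) * X' p = k * g p], and [k], the ratio of total masses, is what sends [v] to [b]. *)
exists (fun p => Q (F a + k * (G p - G u))).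
have kE : k * (G v - G u) = F b - F a.
  rewrite /k (FTC2_continuous ab cf Ff) (FTC2_continuous (ltW uv) cg Gg).
  rewrite divfK// subr_eq0 eq_sym lt_eqF// -subr_gt0.
  have [|z _ ->] := @MVT R G g u v uv; first exact: within_continuousT.
  by rewrite mulr_gt0// subr_gt0.
split.
- by rewrite subrr mulr0 addr0 QF.
- by rewrite kE addrC subrK QF.
- move=> p.
  have d1 : is_derive p (1 : R) (fun p => F a + k * (G p - G u)) (k * g p).
    have -> : k * g p = 0 + (k *: (g p - 0)) by rewrite add0r subr0.
    by apply: is_deriveD; apply: is_deriveZ; apply: is_deriveB.
  rewrite mulrC.
  exact: (@is_derive1_comp _ Q _ _ _ _ (Qd _) d1).
Unshelve. all: by end_near. Qed.

(** * Tools for the one-dimensional inequality *)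

Lemma tonelli_rectangle d1 d2 (T1 : measurableType d1) (T2 : measurableType d2)
    (R : realType) (m1 : {sigma_finite_measure set T1 -> \bar R})
    (m2 : {sigma_finite_measure set T2 -> \bar R})
    (A : set T1) (B : set T2) (f : T1 * T2 -> \bar R) :
  measurable A -> measurable B -> measurable_fun [set: T1 * T2] f ->
  (forall z, 0 <= f z)%E ->
  (\int[m1]_(x in A) \int[m2]_(y in B) f (x, y) =
   \int[m2]_(y in B) \int[m1]_(x in A) f (x, y))%E.
Proof.
move=> mA mB mf f0.
pose g := f \_ (A `*` B).
have mg : measurable_fun [set: T1 * T2] g.
  apply: (measurable_restrictT f (measurableX mA mB)).1.
  exact: measurable_funTS.
have g0 z : (0 <= g z)%E by rewrite /g patchE; case: ifP.
rewrite integral_mkcond [RHS]integral_mkcond.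
have memAB x y : ((x, y) \in A `*` B) = (x \in A) && (y \in B).
  apply/idP/andP; first by rewrite inE => -[/= ? ?]; rewrite !inE.
  by rewrite !inE => -[? ?].
transitivity (\int[m1]_x \int[m2]_y g (x, y))%E; last rewrite (fubini_tonelli g mg g0).
- apply: eq_integral => x _; rewrite patchE; case: ifPn => xA.
    rewrite integral_mkcond; apply: eq_integral => y _.
    by rewrite /g !patchE memAB xA.
  rewrite integral0_eq// => y _.
  by rewrite /g patchE memAB (negbTE xA).
- apply: eq_integral => y _; rewrite patchE; case: ifPn => yB.
    rewrite [RHS]integral_mkcond; apply: eq_integral => x _.
    by rewrite /g !patchE memAB yB andbT.
  rewrite integral0_eq// => x _.
  by rewrite /g patchE memAB (negbTE yB) andbF.
Qed.

Lemma powR_continuous_at {R : realType} (x r : R) : 0 < x ->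
  {for x, continuous (fun y => y `^ r)}.
Proof.
move=> x0; apply: differentiable_continuous; apply/derivable1_diffP.
by apply: derivable_powR; rewrite in_itv/= x0.
Qed.

Lemma continuous_powR {R : realType} (f : R -> R) (r : R) :
  (forall x, 0 < f x) -> continuous f -> continuous (fun x => f x `^ r).
Proof.
move=> f0 cf x.
apply: (@continuous_comp _ _ _ f (fun y => y `^ r)); first exact: cf.
exact: powR_continuous_at.
Qed.

(** A linearized Hoelder inequality: when [U] and [V] bound the integrals of [u] and [v], the last
    factor integrates to at most 1. It is Young's inequality for [u / U] and [v / V] with exponents
    [1 / (1 - c)] and [1 / c]. *)
Lemma weighted_AGM {R : realType} (c u v U V : R) : 0 < c -> c < 1 ->
  0 <= u -> 0 <= v -> 0 < U -> 0 < V ->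
  u `^ (1 - c) * v `^ c <=
  U `^ (1 - c) * V `^ c * ((1 - c) / U * u + c / V * v).
Proof.
move=> c0 c1 u0 v0 U0 V0.
have c1' : 0 < 1 - c by rewrite subr_gt0.
have uU : 0 <= u / U by rewrite divr_ge0// ltW.
have vV : 0 <= v / V by rewrite divr_ge0// ltW.
rewrite -{1}(divfK (lt0r_neq0 U0) u) -{1}(divfK (lt0r_neq0 V0) v).
rewrite (powRM _ uU (ltW U0)) (powRM _ vV (ltW V0)).
rewrite [leLHS](_ : _ = U `^ (1 - c) * V `^ c * ((u / U) `^ (1 - c) * (v / V) `^ c)); last by ring.
rewrite ler_pM2l ?mulr_gt0 ?powR_gt0//.
have := @conjugate_powR R ((u / U) `^ (1 - c)) ((v / V) `^ c) (1 - c)^-1 c^-1.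
rewrite !powR_ge0 !invr_gt0 !invrK subrK -!powRrM !divff ?lt0r_neq0//.
rewrite !powRr1// => /(_ isT isT c1' c0 erefl) h.
by rewrite (le_trans h)// le_eqVlt; apply/orP; left; apply/eqP; ring.
Qed.

Lemma integral_gaussian {R : realType} (b m : R) : 0 < b ->
  (\int[lebesgue_measure]_x (expR (- b * (x - m) ^+ 2))%:E =
   (Num.sqrt (pi / b))%:E)%E.
Proof.
move=> b0.
(* The standard deviation for which the normal density has exponent [- b * (x - m) ^+ 2]. *)
pose s : R := Num.sqrt ((2 * b)^-1).
have s2 : s ^+ 2 = (2 * b)^-1 by rewrite sqr_sqrtr// invr_ge0 mulr_ge0// ltW.
have s0 : s != 0 by rewrite gt_eqF// sqrtr_gt0 invr_gt0 mulr_gt0.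
have pk := @normal_peak_gt0 R s s0.
have pkE : normal_peak s = (Num.sqrt (pi / b))^-1.
  rewrite /normal_peak s2; congr (Num.sqrt _)^-1.
  by field; rewrite lt0r_neq0.
have := integral_normal_pdf m s.
under eq_integral => x _.
  rewrite normal_pdfE//.
  rewrite (_ : normal_fun m s x = expR (- b * (x - m) ^+ 2)).
    rewrite EFinM; over.
  rewrite /normal_fun s2; congr expR; rewrite -mulr_natr.
  by field; rewrite lt0r_neq0.
have mE : measurable_fun [set: R] (fun x => (expR (- b * (x - m) ^+ 2))%:E).
  apply/measurable_EFinP; apply: measurableT_comp => //.
  apply: measurable_funM => //; apply: (measurable_funX 2%N).
  exact: measurable_funB.
rewrite ge0_integralZl_EFin//; last exact: ltW.
set I := (\int[_]_x _)%E => h.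
have : ((normal_peak s)^-1%:E * ((normal_peak s)%:E * I) = (normal_peak s)^-1%:E * 1)%E.
  by rewrite h.
rewrite muleA -EFinM mulVf ?gt_eqF// mul1e mule1 => ->.
by rewrite pkE invrK.
Qed.

(** The Jacobian [x' * y'] is split into powers [a] and [1 - a]. The first is absorbed by [fx] and
    [gy] through the transport equations; the second is at most [((x' + y') / 2) ^ (2 - 2 * a)] by
    AM-GM and joins the power of [hz]. *)
Lemma transport_AGM {R : realType} (a fx gy hz x' y' k l p q : R) :
  a < 1 -> 0 < fx -> 0 < gy -> 0 <= hz -> 0 < x' -> 0 < y' -> 0 < k -> 0 < l ->
  0 < p -> 0 < q -> fx * x' = k * p -> gy * y' = l * q ->
  fx `^ a * gy `^ a * hz `^ (2 - 2 * a) * x' * y' <=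
  k `^ a * l `^ a * ((p * q) `^ a * (hz * ((x' + y') / 2)) `^ (2 - 2 * a)).
Proof.
move=> a1 fx0 gy0 hz0 x0 y0 k0 l0 p0 q0 fE gE.
have split z : 0 < z -> z = z `^ a * z `^ (1 - a).
  move=> z0; rewrite -powRD ?lt0r_neq0 ?implybT//.
  by rewrite addrC subrK powRr1// ltW.
rewrite [in leLHS](split x' x0) [in leLHS](split y' y0).
rewrite [leLHS](_ : _ = (fx * x') `^ a * (gy * y') `^ a * (hz `^ (2 - 2 * a) * (x' * y') `^ (1 - a))); last first.
  by rewrite !powRM ?ltW//; ring.
rewrite fE gE (powRM _ (ltW k0) (ltW p0)) (powRM _ (ltW l0) (ltW q0)).
rewrite (powRM _ (ltW p0) (ltW q0)) (powRM _ hz0); last first.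
  by rewrite divr_ge0 ?addr_ge0 ?ltW.
rewrite [leLHS](_ : _ = k `^ a * l `^ a * (p `^ a * q `^ a * (hz `^ (2 - 2 * a) * (x' * y') `^ (1 - a)))); last first.
  by ring.
rewrite ler_wpM2l ?mulr_ge0 ?powR_ge0// ler_wpM2l ?mulr_ge0 ?powR_ge0//.
rewrite ler_wpM2l ?powR_ge0//.
rewrite (_ : 2 - 2 * a = 2%:R * (1 - a)); last by ring.
have s0 : 0 <= (x' + y') / 2 by rewrite divr_ge0 ?addr_ge0 ?ltW.
rewrite powRrM powR_mulrn//.
apply: ge0_ler_powR; rewrite ?nnegrE ?subr_ge0 ?sqr_ge0 ?mulr_ge0 ?(ltW a1) ?(ltW x0) ?(ltW y0)//.
have : 0 <= (x' - y') ^+ 2 by exact: sqr_ge0.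
by nra.
Qed.

(** Completing the square, p^2 + (s - p)^2 = s^2 / 2 + 2 (p - s / 2)^2. The Gaussian in [p] is
    displayed as a power [2 * a - 1], which is the Hoelder weight left over by the exponent
    [2 - 2 * a]; this is the source of the rate [2 * a / (2 * a - 1)]. *)
Lemma gauss_fun_pair {R : realType} (a s p : R) : 1 < 2 * a ->
  (gauss_fun p * gauss_fun (s - p)) `^ a =
  expR (- (a / 2) * (s - 0) ^+ 2) *
  expR (- (2 * a / (2 * a - 1)) * (p - s / 2) ^+ 2) `^ (2 * a - 1).
Proof.
move=> a1; rewrite /gauss_fun -expRD -!expRM -expRD; congr expR.
by field; rewrite subr_eq0 gt_eqF.
Qed.

(** The change of variable [q = s - p] at fixed [p], followed by Tonelli, slices the square along
    the lines [p + q = s]; the interval in the hypothesis is the part of such a line inside the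
    square, parametrized by [p]. *)
Lemma shear_square_le {R : realType} (N : R) (F : R * R -> R) (B : R -> R) :
  0 <= N ->
  measurable_fun [set: R * R] F -> (forall z, 0 <= F z) ->
  (forall p, continuous (fun q => F (p, q))) ->
  measurable_fun setT B ->
  (forall s, \int[lebesgue_measure]_(p in
      `[Num.max (- N) (s - N), Num.min N (s + N)]%classic%R)
       (F (p, s - p)%R)%:E <= (B s)%:E)%E ->
  (\int[lebesgue_measure]_(p in `[(- N)%R, N])
     \int[lebesgue_measure]_(q in `[(- N)%R, N]) (F (p, q))%:E <=
   \int[lebesgue_measure]_s (B s)%:E)%E.
Proof.
move=> N0 mF F0 cF mB FB.
pose G (z : R * R) := F (z.1, z.2 - z.1).
have mG : measurable_fun [set: R * R] G.
  apply: measurableT_comp => //; apply: measurable_fun_pair => //=.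
  exact: measurable_funB.
(* The parallelogram onto which [(p, q)], sent to [(p, p + q)], maps the square. *)
pose b (z : R * R) := (- N <= z.1 <= N) && (z.1 - N <= z.2 <= z.1 + N).
have mb : measurable_fun [set: R * R] b.
  have m1 : measurable_fun [set: R * R] fst by exact: measurable_fst.
  have m2 : measurable_fun [set: R * R] snd by exact: measurable_snd.
  apply: measurable_and; apply: measurable_and; apply: measurable_fun_ler => //.
    exact: measurable_funB.
  exact: measurable_funD.
pose H (z : R * R) := if b z then G z else 0.
have mH : measurable_fun [set: R * R] H by exact: measurable_fun_ifT.
have H0 z : (0 <= (H z)%:E)%E by rewrite lee_fin /H; case: ifP => // _; exact: F0.
rewrite (_ : (\int[_]_(p in _) _)%E =
    (\int[lebesgue_measure]_p \int[lebesgue_measure]_s (H (p, s))%:E)%E); last first.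
  rewrite integral_mkcond; apply: eq_integral => p _.
  rewrite patchE mem_setE in_itv/= /H /b /=; case: ifPn => pN; last first.
    by rewrite integral0.
  transitivity (\int[lebesgue_measure]_(s in `[p - N, p + N]%classic%R) (G (p, s))%:E)%E; last first.
    by rewrite integral_mkcond; apply: eq_integral => s _; rewrite patchE mem_setE in_itv/=; case: ifP.
  have d1 (s : R) : is_derive s (1 : R) (fun s => s - p) (cst 1 s).
    have -> : cst 1 s = 1 - 0 :> R by rewrite subr0.
    exact: is_deriveB.
  have c1 : continuous (cst 1 : R -> R) by move=> s; exact: cvg_cst.
  have pN' : p - N <= p + N by lra.
  have := integral_substitution pN' d1 c1 (fun=> ltr01) (cF p).
  rewrite (_ : p - N - p = - N); last by ring.
  rewrite (_ : p + N - p = N); last by ring.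
  by move=> ->; apply: eq_integral => s _; rewrite /G/= mulr1.
have mHE : measurable_fun [set: R * R] (EFin \o H) by exact/measurable_EFinP.
rewrite (@fubini_tonelli _ _ _ _ R (@lebesgue_measure R) (@lebesgue_measure R) (EFin \o H) mHE H0).
apply: ge0_le_integral => //.
- by move=> s _; apply: integral_ge0 => p _; exact: H0.
- exact: measurable_fun_fubini_tonelli_G.
- exact/measurable_EFinP.
move=> s _; apply: le_trans (FB s); rewrite le_eqVlt; apply/orP; left; apply/eqP.
rewrite [RHS]integral_mkcond; apply: eq_integral => p _.
rewrite patchE /H /b /G/= mem_setE in_itv/= ge_max le_min.
have -> : (- N <= p <= N) && (p - N <= s <= p + N) =
          (- N <= p) && (s - N <= p) && ((p <= N) && (p <= s + N)).
  by rewrite !lerBlDr; do 4!case: (_ <= _).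
by case: ifP.
Qed.

(** * The sharp Young inequality on the line *)

Lemma is_derive_increasing {R : realType} (X dX : R -> R) :
  (forall p : R, is_derive p (1 : R) X (dX p)) -> (forall p, 0 < dX p) ->
  {homo X : x y / x <= y}.
Proof.
move=> Xd X0 x y xy; rewrite -subr_ge0.
have [|z _ ->] := @MVT_segment R X dX x y xy (fun z _ => Xd z).
  by apply: within_continuousT; exact: is_derive_continuous Xd.
by rewrite mulr_ge0 ?subr_ge0// ltW.
Qed.

Lemma measurable_fun_powR d (T : measurableType d) {R : realType} (u : T -> R)
    (r : R) :
  measurable_fun [set: T] u -> measurable_fun [set: T] (fun z => u z `^ r).
Proof. exact: measurableT_comp (measurable_powR r). Qed.

(* The total mass of exp(- (2a / (2a - 1)) p^2). *)
Definition gauss_dual_mass {R : realType} (a : R) : R :=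
  Num.sqrt (pi / (2 * a / (2 * a - 1))).

(** Here [m] is the Gaussian mass kept on [[- N, N]], so [F / m] and [G / m] are the factors [k] of
    the two transports. The Gaussian integrals on the right run over the whole line, which only
    enlarges the bound. [H] is halved because AM-GM produces half of the derivative of [X - Y] along
    a line. *)
Lemma young_line_truncated {R : realType} (a M N e F G H m : R) (f g h : R -> R) :
  1 < 2 * a -> a < 1 -> 0 < M -> 0 < N -> 0 < e ->
  (forall x, e <= f x) -> (forall x, e <= g x) -> (forall x, e <= h x) ->
  continuous f -> continuous g -> continuous h ->
  F = \int[lebesgue_measure]_(x in `[- M, M]) f x ->
  G = \int[lebesgue_measure]_(x in `[- M, M]) g x ->
  H = \int[lebesgue_measure]_(x in `[- (2 * M), 2 * M]) h x ->
  m = \int[lebesgue_measure]_(x in `[- N, N]) gauss_fun x ->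
  (\int[lebesgue_measure]_(y in `[(- M)%R, M])
    \int[lebesgue_measure]_(x in `[(- M)%R, M])
      (f x `^ a * g y `^ a * h (x - y) `^ (2 - 2 * a))%:E <=
  ((F / m) `^ a * (G / m) `^ a *
   (Num.sqrt (pi / (a / 2)) *
    (gauss_dual_mass a `^ (2 * a - 1) * (H / 2) `^ (2 - 2 * a))))%:E)%E.
Proof.
move=> a1 a1' M0 N0 e0 fe ge he cf cg ch FE GE HE mE.
have a0 : 0 < a by lra.
have f0 x : 0 < f x by exact: lt_le_trans (fe x).
have g0 x : 0 < g x by exact: lt_le_trans (ge x).
have h0 x : 0 < h x by exact: lt_le_trans (he x).
have ga0 x : 0 < @gauss_fun R x by exact: expR_gt0.
have cga := @continuous_gauss_fun R.
have pos (u : R -> R) (c : R) : 0 < c -> (forall x, 0 < u x) -> continuous u ->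
    0 < \int[lebesgue_measure]_(x in `[- c, c]) u x.
  move=> c0 u0 cu; have [U Uu] := primitive_exists cu.
  rewrite (FTC2_continuous _ cu Uu) ?subr_gt0; last lra.
  have cc : - c < c by lra.
  rewrite -subr_gt0.
  have [|z _ ->] := @MVT R U u (- c) c cc (fun z _ => Uu z).
    by apply: within_continuousT; exact: is_derive_continuous Uu.
  by rewrite mulr_gt0// ?subr_gt0.
have F0 : 0 < F by rewrite ?FE ?GE ?mE; exact: pos.
have G0 : 0 < G by rewrite ?FE ?GE ?mE; exact: pos.
have H0 : 0 < H by rewrite HE; apply: pos => //; rewrite mulr_gt0.
have m0 : 0 < m by rewrite ?FE ?GE ?mE; exact: pos.
have k0 : 0 < F / m by rewrite divr_gt0.
have l0 : 0 < G / m by rewrite divr_gt0.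
have MM : - M <= M by lra.
have NN : - N < N by lra.
have [X [XN XN' Xd]] := transport_exists e0 fe cf cga ga0 MM NN.
have [Y [YN YN' Yd]] := transport_exists e0 ge cg cga ga0 MM NN.
rewrite -FE -mE in Xd; rewrite -GE -mE in Yd.
set k := F / m in k0 Xd *; set l := G / m in l0 Yd *.
pose dX p := k * gauss_fun p / f (X p).
pose dY p := l * gauss_fun p / g (Y p).
change (forall p : R, is_derive p (1 : R) X (dX p)) in Xd.
change (forall p : R, is_derive p (1 : R) Y (dY p)) in Yd.
have cX := is_derive_continuous Xd.
have cY := is_derive_continuous Yd.
have dX0 p : 0 < dX p by rewrite divr_gt0// mulr_gt0.
have dY0 p : 0 < dY p by rewrite divr_gt0// mulr_gt0.
have cdX : continuous dX.
  move=> p; apply: cvgM; first by apply: cvgM; [exact: cvg_cst|exact: cga].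
  apply: cvgV; first by rewrite gt_eqF.
  by apply: (@continuous_comp _ _ _ X f); [exact: cX|exact: cf].
have cdY : continuous dY.
  move=> p; apply: cvgM; first by apply: cvgM; [exact: cvg_cst|exact: cga].
  apply: cvgV; first by rewrite gt_eqF.
  by apply: (@continuous_comp _ _ _ Y g); [exact: cY|exact: cg].
have dXE p : f (X p) * dX p = k * gauss_fun p.
  by rewrite /dX mulrCA divff ?mulr1// gt_eqF.
have dYE p : g (Y p) * dY p = l * gauss_fun p.
  by rewrite /dY mulrCA divff ?mulr1// gt_eqF.
clearbody dX dY.
have dXge0 p : 0 <= dX p by exact: ltW.
have dYge0 p : 0 <= dY p by exact: ltW.
have cmeas (u : R -> R) : continuous u -> measurable_fun setT u.
  exact: continuous_measurable_fun.
pose c := 2 - 2 * a; rewrite -/c.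
pose P (p q : R) := f (X p) `^ a * g (Y q) `^ a * h (X p - Y q) `^ c * dX p * dY q.
have subX y : (\int[lebesgue_measure]_(x in `[(- M)%R, M])
      (f x `^ a * g y `^ a * h (x - y) `^ c)%:E =
    \int[lebesgue_measure]_(p in `[(- N)%R, N])
      (f (X p) `^ a * g y `^ a * h (X p - y) `^ c * dX p)%:E)%E.
  have := integral_substitution (ltW NN) Xd cdX dX0
    (G := fun x => f x `^ a * g y `^ a * h (x - y) `^ c).
  rewrite XN XN'; apply => x; apply: cvgM.
    by apply: cvgM; [exact: continuous_powR|exact: cvg_cst].
  apply: (@continuous_powR _ (fun x => h (x - y))) => // z.
  apply: (@continuous_comp _ _ _ (fun x => x - y) h); last exact: ch.
  by apply: cvgB; [exact: cvg_id|exact: cvg_cst].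
under eq_integral do rewrite subX.
pose Q (z : R * R) := (f (X z.2) `^ a * g z.1 `^ a * h (X z.2 - z.1) `^ c * dX z.2)%:E.
have pow0 u r : 0 <= u `^ r :> R by exact: powR_ge0.
rewrite (@tonelli_rectangle _ _ _ _ R lebesgue_measure lebesgue_measure _ _ Q)//; last 2 first.
- apply/measurable_EFinP; apply: measurable_funM; [apply: measurable_funM; [apply: measurable_funM|]|].
  + apply: measurable_fun_powR.
    apply: (measurableT_comp (cmeas _ cf)).
    by apply: (measurableT_comp (cmeas _ cX)).
  + apply: measurable_fun_powR.
    by apply: (measurableT_comp (cmeas _ cg)).
  + apply: measurable_fun_powR.
    apply: (measurableT_comp (cmeas _ ch)); apply: measurable_funB => //.
    by apply: (measurableT_comp (cmeas _ cX)).
  + by apply: (measurableT_comp (cmeas _ cdX)).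
- by move=> z; rewrite /Q lee_fin !mulr_ge0.
have subY p : (\int[lebesgue_measure]_(y in `[(- M)%R, M]) Q (y, p) =
    \int[lebesgue_measure]_(q in `[(- N)%R, N]) (P p q)%:E)%E.
  have := integral_substitution (ltW NN) Yd cdY dY0
    (G := fun y => f (X p) `^ a * g y `^ a * h (X p - y) `^ c * dX p).
  rewrite YN YN'; apply => y; apply: cvgM; last exact: cvg_cst.
  apply: cvgM.
    by apply: cvgM; [exact: cvg_cst|exact: continuous_powR].
  apply: (@continuous_powR _ (fun y => h (X p - y))) => // z.
  apply: (@continuous_comp _ _ _ (fun x => X p - x) h); last exact: ch.
  by apply: cvgB; [exact: cvg_cst|exact: cvg_id].
under eq_integral do rewrite subY.
pose U := gauss_dual_mass a; rewrite -/U.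
have b0 : 0 < 2 * a / (2 * a - 1) by rewrite divr_gt0; lra.
have U0 : 0 < U by rewrite /U sqrtr_gt0 divr_gt0// pi_gt0.
pose V := H / 2; rewrite -/V.
have V0 : 0 < V by rewrite divr_gt0.
pose K := k `^ a * l `^ a * (U `^ (2 * a - 1) * V `^ c).
have K0 : 0 < K by rewrite !mulr_gt0 ?powR_gt0.
pose E s : R := expR (- (a / 2) * (s - 0) ^+ 2).
have measE : measurable_fun [set: R] E.
  apply: measurableT_comp => //.
  apply: measurable_funM => //; apply: (measurable_funX 2%N).
  exact: measurable_funB.
(* The right-hand side is the integral of [K * E s], so it remains to bound the integral over each
   line [p + q = s] by [K * E s]. *)
have IE : (\int[lebesgue_measure]_s (K * E s)%:E =
    (K * Num.sqrt (pi / (a / 2)))%:E)%E.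
  under eq_integral do rewrite EFinM.
  rewrite ge0_integralZl_EFin//; last 3 first.
  - by move=> s _; rewrite lee_fin expR_ge0.
  - exact/measurable_EFinP.
  - exact: ltW.
  by rewrite /E integral_gaussian ?divr_gt0// EFinM.
rewrite (_ : (_ * (_ * _))%:E = (K * Num.sqrt (pi / (a / 2)))%:E)%E; last first.
  by congr EFin; rewrite /K; ring.
rewrite -IE.
apply: (shear_square_le (F := fun z => P z.1 z.2)) => //=.
- exact: ltW.
- have m1 : measurable_fun [set: R * R] fst by exact: measurable_fst.
  have m2 : measurable_fun [set: R * R] snd by exact: measurable_snd.
  apply: measurable_funM; [apply: measurable_funM; [apply: measurable_funM; [apply: measurable_funM|]|]|].
  + apply: measurable_fun_powR; apply: (measurableT_comp (cmeas _ cf)).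
    exact: (measurableT_comp (cmeas _ cX)).
  + apply: measurable_fun_powR; apply: (measurableT_comp (cmeas _ cg)).
    exact: (measurableT_comp (cmeas _ cY)).
  + apply: measurable_fun_powR; apply: (measurableT_comp (cmeas _ ch)).
    apply: measurable_funB; first exact: (measurableT_comp (cmeas _ cX)).
    exact: (measurableT_comp (cmeas _ cY)).
  + exact: (measurableT_comp (cmeas _ cdX)).
  + exact: (measurableT_comp (cmeas _ cdY)).
- by move=> z; rewrite /P !mulr_ge0.
- move=> p q; rewrite /P /=; apply: cvgM; last exact: cdY.
  apply: cvgM; last exact: cvg_cst.
  apply: cvgM.
    apply: cvgM; first exact: cvg_cst.
    apply: (@continuous_powR _ (fun q => g (Y q))) => // z.
    by apply: (@continuous_comp _ _ _ Y g); [exact: cY|exact: cg].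
  apply: (@continuous_powR _ (fun q => h (X p - Y q))) => // z.
  apply: (@continuous_comp _ _ _ (fun q => X p - Y q) h); last exact: ch.
  by apply: cvgB; [exact: cvg_cst|exact: cY].
- exact: measurable_funM.
move=> s; set al := Num.max _ _; set be := Num.min _ _.
(* When [|s| > 2 * N] the line misses the square. *)
have [ab|ba] := leP al be; last first.
  rewrite set_itv_ge ?integral_set0 ?bnd_simp -?ltNge//.
  by rewrite lee_fin mulr_ge0 ?expR_ge0// ltW.
pose w p : R := expR (- (2 * a / (2 * a - 1)) * (p - s / 2) ^+ 2).
(* The argument of [h] along the line. Since [q = s - p] runs backwards, the difference of the maps
   has the sum of their derivatives as derivative, and so it is increasing. *)
pose Z p := X p - Y (s - p).
pose dZ p := dX p + dY (s - p).
pose D p := h (Z p) * (dZ p / 2).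
have Zd p : is_derive p (1 : R) Z (dZ p).
  have d1 : is_derive p (1 : R) (fun p => s - p) (- 1).
    rewrite (_ : - 1 = 0 - 1); last by rewrite sub0r.
    exact: is_deriveB.
  have d2 := @is_derive1_comp R Y (fun p => s - p) p _ _ (Yd (s - p)) d1.
  rewrite /dZ (_ : dX p + _ = dX p - dY (s - p) * - 1); last by rewrite mulrN1 opprK.
  exact: is_deriveB.
have csub : continuous (fun p => s - p).
  by move=> p; apply: cvgB; [exact: cvg_cst|exact: cvg_id].
have cdZ : continuous dZ.
  move=> p; apply: cvgD; first exact: cdX.
  by apply: (@continuous_comp _ _ _ (fun p => s - p) dY); [exact: csub|exact: cdY].
have cZ := is_derive_continuous Zd.
have dZ0 p : 0 < dZ p by rewrite addr_gt0.
have mw : measurable_fun [set: R] w.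
  apply: measurableT_comp => //.
  apply: measurable_funM => //; apply: (measurable_funX 2%N).
  exact: measurable_funB.
have mD : measurable_fun [set: R] D.
  apply: measurable_funM; first exact: (measurableT_comp (cmeas _ ch) (cmeas _ cZ)).
  by apply: measurable_funM => //; exact: cmeas.
have D0 p : 0 <= D p by rewrite mulr_ge0 ?divr_ge0// ltW.
have w0 p : 0 <= w p by exact: expR_ge0.
have Iw : (\int[lebesgue_measure]_(p in `[al, be]) (w p)%:E <= U%:E)%E.
  rewrite -(integral_gaussian (s / 2) b0).
  apply: ge0_subset_integral => //.
    exact/measurable_EFinP.
  by move=> p _; rewrite lee_fin.
have incX := is_derive_increasing Xd dX0.
have incY := is_derive_increasing Yd dY0.
have [alN alN'] : - N <= al /\ s - al <= N.
  by rewrite /al; split; [rewrite le_max lexx|rewrite lerBlDr -lerBlDl le_max lexx orbT].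
have [beN beN'] : be <= N /\ - N <= s - be.
  by rewrite /be; split; [rewrite ge_min lexx|rewrite lerBrDr addrC -lerBrDr opprK ge_min lexx orbT].
(* Points of the slice have both coordinates in [[- N, N]], where [X] and [Y] take values in
   [[- M, M]]. *)
have Zal : - (2 * M) <= Z al.
  have h1 := incX _ _ alN; have h2 := incY _ _ alN'.
  by rewrite /Z; rewrite XN in h1; rewrite YN' in h2; lra.
have Zbe : Z be <= 2 * M.
  have h1 := incX _ _ beN; have h2 := incY _ _ beN'.
  by rewrite /Z; rewrite XN' in h1; rewrite YN in h2; lra.
(* Substituting [x = Z p] turns this into half the integral of [h] over [[Z al, Z be]], a part of
   [[- 2M, 2M]]. *)
have ID : (\int[lebesgue_measure]_(p in `[al, be]) (D p)%:E <= V%:E)%E.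
  have -> : V%:E = (2^-1%:E * \int[lebesgue_measure]_(x in `[(- (2 * M))%R, (2 * M)%R]) (h x)%:E)%E.
    rewrite /V HE mulrC EFinM /Rintegral fineK//.
    by apply: integrable_fin_num => //; exact: continuous_integrable_itv.
  under eq_integral => p _.
    rewrite (_ : D p = 2^-1 * (h (Z p) * dZ p)); last by rewrite /D; ring.
    rewrite EFinM; over.
  rewrite ge0_integralZl_EFin//; last 2 first.
  - by move=> p _; rewrite lee_fin mulr_ge0// ltW.
  - apply/measurable_EFinP/measurable_funTS; apply: measurable_funM.
      exact: (measurableT_comp (cmeas _ ch) (cmeas _ cZ)).
    exact: cmeas.
  rewrite -(integral_substitution ab Zd cdZ dZ0 ch).
  rewrite lee_pmul2l ?lte_fin ?invr_gt0//.
  apply: ge0_subset_integral => //.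
  - by apply/measurable_EFinP; apply: measurable_funTS; exact: cmeas.
  - by move=> x _; rewrite lee_fin ltW.
  - by apply: subset_itv; rewrite bnd_simp.
have c0 : 0 < c by rewrite /c; lra.
have c1 : c < 1 by rewrite /c; lra.
have cE : 1 - c = 2 * a - 1 by rewrite /c; ring.
(* [E s] does not depend on [p]; what remains is [w p ^ (1 - c) * D p ^ c], to which the linearized
   Hoelder inequality applies with the bounds [U] and [V] just found. *)
have bound p : P p (s - p) <= K * E s * ((1 - c) / U * w p + c / V * D p).
  have h1 := @transport_AGM _ a (f (X p)) (g (Y (s - p))) (h (Z p)) (dX p)
    (dY (s - p)) k l (gauss_fun p) (gauss_fun (s - p)) a1' (f0 _) (g0 _)
    (ltW (h0 _)) (dX0 _) (dY0 _) k0 l0 (ga0 _) (ga0 _) (dXE _) (dYE _).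
  apply: (le_trans h1); rewrite -/c -/(dZ p) -/(D p) gauss_fun_pair//.
  have h2 := weighted_AGM c0 c1 (w0 p) (D0 p) U0 V0.
  rewrite cE in h2 *.
  rewrite -/(E s) -/(w p).
  have -> : K * E s * ((2 * a - 1) / U * w p + c / V * D p) =
     k `^ a * l `^ a * (E s * (U `^ (2 * a - 1) * V `^ c * ((2 * a - 1) / U * w p + c / V * D p))).
    by rewrite /K; ring.
  rewrite ler_wpM2l ?mulr_ge0// -mulrA ler_wpM2l ?expR_ge0//.
have csY : continuous (fun p => Y (s - p)).
  by move=> p; apply: (@continuous_comp _ _ _ (fun p => s - p) Y); [exact: csub|exact: cY].
have mP : measurable_fun [set: R] (fun p => P p (s - p)).
  apply: measurable_funM; [apply: measurable_funM; [apply: measurable_funM; [apply: measurable_funM|]|]|].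
  + apply: measurable_fun_powR; apply: (measurableT_comp (cmeas _ cf)).
    exact: cmeas.
  + apply: measurable_fun_powR; apply: (measurableT_comp (cmeas _ cg)).
    exact: cmeas.
  + apply: measurable_fun_powR; apply: (measurableT_comp (cmeas _ ch)).
    by apply: measurable_funB; exact: cmeas.
  + exact: cmeas.
  + by apply: (measurableT_comp (cmeas _ cdY)); exact: cmeas.
have mS : measurable_fun [set: R] (fun p => (1 - c) / U * w p + c / V * D p).
  by apply: measurable_funD; apply: measurable_funM.
have c1' : 0 <= 1 - c by rewrite subr_ge0 ltW.
have coefw : 0 <= (1 - c) / U by rewrite divr_ge0// ltW.
have coefD : 0 <= c / V by rewrite divr_ge0// ltW.
have KE0 : 0 <= K * E s by rewrite mulr_ge0 ?expR_ge0// ltW.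
apply: (@le_trans _ _ (\int[lebesgue_measure]_(p in `[al, be])
    ((K * E s)%:E * ((1 - c) / U * w p + c / V * D p)%:E))%E).
  apply: ge0_le_integral => //.
  - by move=> p _; rewrite lee_fin /P !mulr_ge0.
  - by apply/measurable_EFinP; apply: measurable_funTS.
  - by apply: measurable_funeM; apply/measurable_EFinP; apply: measurable_funTS.
  - by move=> p _; rewrite -EFinM lee_fin.
rewrite ge0_integralZl_EFin//; last 2 first.
- by move=> p _; rewrite lee_fin addr_ge0// mulr_ge0.
- by apply/measurable_EFinP; apply: measurable_funTS.
rewrite -[leRHS]mule1 lee_wpmul2l ?lee_fin//.
under eq_integral => p _ do rewrite EFinD (EFinM ((1 - c) / U)) (EFinM (c / V)).
rewrite ge0_integralD//; last 4 first.
- by move=> p _; rewrite -EFinM lee_fin mulr_ge0.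
- by apply: measurable_funeM; apply/measurable_EFinP; apply: measurable_funTS.
- by move=> p _; rewrite -EFinM lee_fin mulr_ge0.
- by apply: measurable_funeM; apply/measurable_EFinP; apply: measurable_funTS.
rewrite !ge0_integralZl_EFin//; last 4 first.
- by move=> p _; rewrite lee_fin.
- by apply/measurable_EFinP; apply: measurable_funTS.
- by move=> p _; rewrite lee_fin.
- by apply/measurable_EFinP; apply: measurable_funTS.
(* The integrals of [w] and [D] are at most [U] and [V], so the weighted sum is at most
   [(1 - c) + c]. *)
have -> : 1%E = (((1 - c) / U)%:E * U%:E + (c / V)%:E * V%:E)%E.
  by rewrite -!EFinM !divfK ?lt0r_neq0// -EFinD subrK.
by apply: leeD; apply: lee_wpmul2l; rewrite ?lee_fin.
Qed.

(** The truncated constant after [N] has gone to infinity. Its factors come from the Gaussian masses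
    in the two transports, from the Gaussian in [s = p + q], and from Hoelder along the lines
    together with the halving of [H]. *)
Definition young_const {R : realType} (a : R) : R :=
  (Num.sqrt pi)^-1 `^ (2 * a) *
  (Num.sqrt (pi / (a / 2)) *
   (gauss_dual_mass a `^ (2 * a - 1) * 2^-1 `^ (2 - 2 * a))).

Lemma gauss_truncated_cvg (R : realType) :
  (\int[lebesgue_measure]_(x in `[- (n.+1%:R : R), n.+1%:R]) gauss_fun x)
    @[n --> \oo] --> Num.sqrt (pi : R).
Proof.
apply: fine_cvg.
rewrite -integralT_gauss.
have -> : [set: R] = \bigcup_n `[- (n.+1%:R : R), n.+1%:R]%classic.
  apply/seteqP; split => // x _; exists (Num.bound `|x|) => //=.
  rewrite in_itv/= -ler_norml (le_trans (ltW (archi_boundP _)))//.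
  by rewrite ler_nat.
apply: ge0_nondecreasing_set_cvg_integral.
- move=> n m nm; apply/subsetPset; apply: subset_itv; rewrite bnd_simp.
    by rewrite lerN2 ler_nat.
  by rewrite ler_nat.
- by move=> i; exact: measurable_itv.
- move=> i; apply/measurable_EFinP/measurable_funTS.
  exact: measurable_gauss_fun.
- by move=> i x _; rewrite lee_fin gauss_fun_ge0.
Qed.

(** The left-hand side does not involve [N], so the truncated bounds pass to the limit as the
    truncated Gaussian mass tends to [sqrt pi]. *)
Lemma young_line {R : realType} (a M e : R) (f g h : R -> R) :
  1 < 2 * a -> a < 1 -> 0 < M -> 0 < e ->
  (forall x, e <= f x) -> (forall x, e <= g x) -> (forall x, e <= h x) ->
  continuous f -> continuous g -> continuous h ->
  (\int[lebesgue_measure]_(y in `[(- M)%R, M])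
    \int[lebesgue_measure]_(x in `[(- M)%R, M])
      (f x `^ a * g y `^ a * h (x - y) `^ (2 - 2 * a))%:E <=
  (young_const a *
   ((\int[lebesgue_measure]_(x in `[(- M)%R, M]) f x)%R `^ a *
    (\int[lebesgue_measure]_(x in `[(- M)%R, M]) g x)%R `^ a *
    (\int[lebesgue_measure]_(x in `[(- (2 * M))%R, (2 * M)%R]) h x)%R `^ (2 - 2 * a)))%:E)%E.
Proof.
move=> a1 a1' M0 e0 fe ge he cf cg ch.
set F := (\int[lebesgue_measure]_(x in `[- M, M]) f x).
set G := (\int[lebesgue_measure]_(x in `[- M, M]) g x).
set H := (\int[lebesgue_measure]_(x in `[- (2 * M), 2 * M]) h x).
have ge0 (u : R -> R) A : (forall x, e <= u x) ->
    0 <= (\int[lebesgue_measure]_(x in A) u x)%R.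
  by move=> ue; apply: Rintegral_ge0 => x _; rewrite (le_trans (ltW e0)).
pose B m := (F / m) `^ a * (G / m) `^ a * (Num.sqrt (pi / (a / 2)) *
    (gauss_dual_mass a `^ (2 * a - 1) * (H / 2) `^ (2 - 2 * a))).
have JB (n : nat) := @young_line_truncated R a M n.+1%:R e F G H _ f g h
  a1 a1' M0 (ltr0Sn _ n) e0 fe ge he cf cg ch erefl erefl erefl erefl.
set J := (X in (X <= _)%E) in JB *.
have J0 : (0 <= J)%E.
  apply: integral_ge0 => y _; apply: integral_ge0 => x _.
  by rewrite lee_fin !mulr_ge0// powR_ge0.
have Jfin : J \is a fin_num.
  by rewrite ge0_fin_numE// (le_lt_trans (JB 0%N))// ltry.
rewrite -(fineK Jfin) lee_fin.
have spi : 0 < Num.sqrt (pi : R) by rewrite sqrtr_gt0 pi_gt0.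
have -> : young_const a * (F `^ a * G `^ a * H `^ (2 - 2 * a)) = B (Num.sqrt pi).
  rewrite /B /young_const.
  have i0 : 0 <= (Num.sqrt (pi : R))^-1 by rewrite invr_ge0 ltW.
  rewrite (powRM _ (ge0 f _ fe) i0) (powRM _ (ge0 g _ ge) i0).
  rewrite (powRM _ (ge0 h _ he)) ?invr_ge0//.
  rewrite (_ : 2 * a = a + a); last by ring.
  rewrite powRD; last by apply/implyP => _; rewrite gt_eqF// invr_gt0.
  move: (F `^ a) (G `^ a) (H `^ _) (_^-1 `^ a) (_ `^ (_ - 1)) (2^-1 `^ _).
  by move: (Num.sqrt (pi / _)) => *; ring.
have cB : B (\int[lebesgue_measure]_(x in `[- (n.+1%:R : R), n.+1%:R]) gauss_fun x)
    @[n --> \oo] --> B (Num.sqrt pi).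
  apply: (continuous_cvg _ _ (@gauss_truncated_cvg R)).
  (* Continuity of the power is available at positive points only, so [u = 0] is treated apart: the
     function is then constant. *)
  have cpow u : 0 <= u -> {for Num.sqrt pi, continuous (fun m : R => (u / m) `^ a)}.
    rewrite le_eqVlt => /predU1P[<-|u0].
      rewrite (_ : (fun _ => _) = cst (0 `^ a)); first exact: cvg_cst.
      by apply/funext => m; rewrite mul0r.
    apply: (@continuous_cvg _ _ _ _ _ _ (fun y : R => y `^ a)).
      by apply: powR_continuous_at; rewrite divr_gt0.
    by apply: cvgM; [exact: cvg_cst|apply: cvgV => //; rewrite gt_eqF].
  apply: cvgM; last exact: cvg_cst.
  by apply: cvgM; apply: cpow; exact: ge0.
apply: (cvgr_to_ge cB); apply: nearW => n.
by rewrite -lee_fin fineK//; exact: JB.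
Qed.

(** * Lebesgue measure on the Borel sets of R^d *)

Section borelRd_theory.
Context {R : realType} {d : nat}.
Implicit Types (a b x : 'rV[R]_d).

Definition cbox (a b : 'rV[R]_d) : set (borelRd R d) :=
  [set x : borelRd R d |
    forall i, a ord0 i <= (x : 'rV[R]_d) ord0 i <= b ord0 i].

(** Rational corners make the union countable; this is what lets closed boxes generate the Borel
    sets. *)
Lemma open_bigcup_rat_cbox (U : set 'rV[R]_d) : open U ->
  U = \bigcup_(q in [set q : 'rV[rat]_d * 'rV[rat]_d |
        cbox (map_mx ratr q.1) (map_mx ratr q.2) `<=` U])
      cbox (map_mx ratr q.1) (map_mx ratr q.2).
Proof.
move=> oU; apply/seteqP; split => [x Ux|x [q /= qU /qU//]].
have /nbhs_ballP[e /= e0 xeU] : nbhs x U by exact: open_nbhs_nbhs.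
have lo i : exists q : rat, ratr q \in `]x ord0 i - e, x ord0 i[.
  by apply: rat_in_itvoo; rewrite ltrBlDr ltrDl.
have hi i : exists q : rat, ratr q \in `]x ord0 i, x ord0 i + e[.
  by apply: rat_in_itvoo; rewrite ltrDl.
have [p pP] := choice lo; have [q qP] := choice hi.
exists (\row_i p i, \row_i q i) => /=.
  move=> y /= yb; apply: xeU; split => // i j; rewrite ord1.
  have := yb j; rewrite !mxE; have := pP j; have := qP j.
  rewrite !in_itv/= => /andP[q1 q2] /andP[p1 p2] /andP[y1 y2].
  by rewrite /ball/= ltr_norml; apply/andP; split; lra.
move=> i; rewrite !mxE.
have := pP i; have := qP i.
by rewrite !in_itv/= => /andP[q1 q2] /andP[p1 p2]; rewrite !ltW.
Qed.

Lemma closed_cbox a b : closed (cbox a b : set 'rV[R]_d).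
Proof.
rewrite (_ : cbox a b = \bigcap_(i in [set: 'I_d])
    ((fun x : 'rV[R]_d => x ord0 i) @^-1` `[a ord0 i, b ord0 i])); last first.
  by apply/seteqP; split => x /=; [move=> xb i _|move=> xb i; have := xb i I];
    rewrite /= in_itv/=.
apply: closed_bigI => i _; apply: closed_comp; last exact: itv_closed.
by move=> x _; exact: coord_continuous.
Qed.

Lemma open_measurable_borelRd (U : set 'rV[R]_d) :
  open U -> measurable (U : set (borelRd R d)).
Proof. by move=> oU; exact: sub_sigma_algebra. Qed.

Lemma closed_measurable_borelRd (C : set 'rV[R]_d) :
  closed C -> measurable (C : set (borelRd R d)).
Proof.
move=> cC; rewrite -(setCK (C : set (borelRd R d))); apply: measurableC.
by apply: open_measurable_borelRd; rewrite openC.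
Qed.

Lemma measurable_cbox a b : measurable (cbox a b).
Proof. by apply: closed_measurable_borelRd; exact: closed_cbox. Qed.

Lemma measurable_borelRd_cbox :
  @measurable _ (borelRd R d) = <<s [set A | exists a b, A = cbox a b] >>.
Proof.
apply/seteqP; split; last first.
  apply: smallest_sub; first exact: sigma_algebra_measurable.
  by move=> _ [a [b ->]]; exact: measurable_cbox.
apply: smallest_sub; first exact: smallest_sigma_algebra.
move=> U /open_bigcup_rat_cbox ->.
pose S := g_sigma_algebraType [set A | exists a b, A = cbox a b].
have : @measurable _ S (\bigcup_(q in [set q : 'rV[rat]_d * 'rV[rat]_d |
        cbox (map_mx ratr q.1) (map_mx ratr q.2) `<=` U])
      cbox (map_mx ratr q.1) (map_mx ratr q.2)); last by [].
rewrite bigcup_mkcond; apply: countable_bigcupT_measurable; first exact: countableP.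
move=> q; case: ifP => _; last exact: measurable0.
by apply: sub_sigma_algebra; do 2!eexists.
Qed.

Lemma measurable_fun_borelRd d' (T : measurableType d') (f : T -> borelRd R d) :
  (forall i, measurable_fun setT (fun t => (f t : 'rV[R]_d) ord0 i)) ->
  measurable_fun setT f.
Proof.
move=> mf; apply: (measurability _ measurable_borelRd_cbox).
move=> _ [_ [a [b ->]] <-].
rewrite setTI (_ : f @^-1` _ = \bigcap_(i in [set: 'I_d])
   ((fun t => (f t : 'rV[R]_d) ord0 i) @^-1` `[a ord0 i, b ord0 i])); last first.
  by apply/seteqP; split => x /=; [move=> xb i _|move=> xb i; have := xb i I];
    rewrite /= in_itv/=.
apply: fin_bigcap_measurable => // i _.
by rewrite -[X in measurable X]setTI; apply: mf.
Qed.

Lemma continuous_measurable_borelRd (f : 'rV[R]_d -> R) : continuous f ->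
  measurable_fun setT (f : borelRd R d -> R).
Proof.
move=> cf; apply: (measurability _ (RGenOInfty.measurableE R)).
move=> _ [_ [x ->] <-]; rewrite setTI; apply: open_measurable_borelRd.
by apply: open_comp; [move=> y _; exact: cf|exact: interval_open].
Qed.

Lemma measurable_coord_borelRd i :
  measurable_fun setT (fun x : borelRd R d => (x : 'rV[R]_d) ord0 i).
Proof. by apply: continuous_measurable_borelRd; exact: coord_continuous. Qed.

Definition cube (M : R) : set (borelRd R d) :=
  cbox (const_mx (- M)) (const_mx M).

Lemma measurable_cube M : measurable (cube M).
Proof. exact: measurable_cbox. Qed.

Lemma cubeP M (x : borelRd R d) :
  cube M x <-> forall i, `|(x : 'rV[R]_d) ord0 i| <= M.
Proof.
split=> h i; have := h i; rewrite ?mxE; first by rewrite -ler_norml.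
by rewrite ler_norml.
Qed.

Lemma bigcup_cube : \bigcup_n cube n%:R = setT.
Proof.
apply/seteqP; split => // x _.
exists (\sum_i Num.bound `|(x : 'rV[R]_d) ord0 i|)%N => //; apply/cubeP => i.
rewrite (le_trans (ltW (archi_boundP (normr_ge0 _))))// ler_nat.
by rewrite (bigD1 i)//= leq_addr.
Qed.

End borelRd_theory.

Lemma lebesgue_cbox_empty {R : realType} d (lam : {measure set (borelRd R d) -> \bar R})
    (a b : 'rV[R]_d) :
  ~ (forall i, a ord0 i <= b ord0 i) -> lam (cbox a b) = 0%E.
Proof.
move=> ab; rewrite (_ : cbox a b = set0) ?measure0//.
apply/seteqP; split => // x xab; apply: ab => i.
by have /andP[/le_trans] := xab i; apply.
Qed.

(** Closed boxes are stable under intersection, generate the Borel sets, and include cubes of finite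
    measure that exhaust the space. Product decomposition and scaling of the measure are both
    obtained from this uniqueness. *)
Lemma lebesgue_measure_unique {R : realType} d
    (l1 l2 : {measure set (borelRd R d) -> \bar R}) :
  is_lebesgue_measure l1 -> is_lebesgue_measure l2 ->
  forall A, measurable A -> l1 A = l2 A.
Proof.
move=> h1 h2 A mA.
apply: (measure_unique _ (fun n => cube n%:R) (@measurable_borelRd_cbox R d)) => //.
- move=> _ _ [a [b ->]] [a' [b' ->]].
  exists (\row_i Num.max (a ord0 i) (a' ord0 i)).
  exists (\row_i Num.min (b ord0 i) (b' ord0 i)).
  apply/seteqP; split => x /=.
    move=> [h h'] i; rewrite !mxE ge_max le_min.
    by have /andP[-> ->] := h i; have /andP[-> ->] := h' i.
  by move=> h; split => i; have := h i; rewrite !mxE ge_max le_min =>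
    /andP[/andP[? ?] /andP[? ?]]; apply/andP.
- by move=> n; do 2!eexists.
- exact: bigcup_cube.
- move=> _ [a [b ->]].
  (* An intersection of boxes may have inverted corners; such a box is empty, and the volume formula
     does not speak of it. *)
  have [ab|ab] := pselect (forall i, a ord0 i <= b ord0 i).
    by rewrite /cbox h1// h2.
  by rewrite !lebesgue_cbox_empty.
- by move=> n; rewrite /cube /cbox h1 ?ltry// => i; rewrite !mxE; have := ler0n R n; lra.
Qed.

Lemma lebesgue_cube_lty {R : realType} d (lam : {measure set (borelRd R d) -> \bar R})
    M :
  is_lebesgue_measure lam -> (lam (cube M) < +oo)%E.
Proof.
move=> h; rewrite /cube.
have [ab|ab] := pselect (forall i,
    (const_mx (- M) : 'rV[R]_d) ord0 i <= (const_mx M : 'rV[R]_d) ord0 i).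
  by rewrite /cbox h// ltry.
by rewrite lebesgue_cbox_empty.
Qed.

(** Tonelli asks for a sigma-finite measure; the cubes of integer size exhaust the space and have
    finite volume. The underlying function is unchanged, so every statement about [lam]
    transfers. *)
Lemma lebesgue_sigma_finite {R : realType} d
    (lam : {measure set (borelRd R d) -> \bar R}) :
  is_lebesgue_measure lam ->
  exists l : {sigma_finite_measure set (borelRd R d) -> \bar R},
    (l : set (borelRd R d) -> \bar R) = lam.
Proof.
move=> h.
have sf : sigma_finite setT lam.
  exists (fun n => cube n%:R); first by rewrite bigcup_cube.
  by move=> n; split; [exact: measurable_cube|exact: lebesgue_cube_lty].
have H1 : isSFinite.axioms_ _ (borelRd R d) R lam.
  by constructor; exact: sfinite_measure_sigma_finite.
have H2 : isSigmaFinite.axioms_ _ (borelRd R d) R lam by constructor.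
pose l : {sigma_finite_measure set (borelRd R d) -> \bar R} :=
  HB.pack (Measure.sort lam) H1 H2.
by exists l.
Qed.

(* Unlike [ge0_le_integral], no measurability is required. *)
Lemma le_integral_ge0 d (T : measurableType d) (R : realType)
    (mu : {measure set T -> \bar R}) (D : set T) (f g : T -> \bar R) :
  (forall x, D x -> 0 <= f x)%E -> (forall x, D x -> f x <= g x)%E ->
  (\int[mu]_(x in D) f x <= \int[mu]_(x in D) g x)%E.
Proof.
move=> f0 fg.
rewrite !ge0_integralE//; last by move=> x Dx; rewrite (le_trans (f0 x Dx))// fg.
apply: le_ereal_sup => _ [h /= hf <-]; exists h => //= x; rewrite (le_trans (hf x))// !patchE; case: ifPn => // xD.
by apply: fg; rewrite inE in xD.
Qed.

(** * Splitting off the first coordinate *)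

Definition rv_cons {R : realType} {d} (z : borelRd R d * measurableTypeR R) : borelRd R d.+1 :=
  row_mx ((z.2 : R)%:M : 'rV[R]_1) (z.1 : 'rV[R]_d) : 'rV[R]_(1 + d).

Lemma rv_cons0 {R : realType} {d} (z : borelRd R d * measurableTypeR R) :
  (rv_cons z : 'rV[R]_d.+1) ord0 ord0 = z.2.
Proof.
rewrite /rv_cons mxE; case: splitP => // j _.
by rewrite mxE !ord1 eqxx mulr1n.
Qed.

Lemma rv_consS {R : realType} {d} (z : borelRd R d * measurableTypeR R) (i : 'I_d) :
  (rv_cons z : 'rV[R]_d.+1) ord0 (lift ord0 i) = (z.1 : 'rV[R]_d) ord0 i.
Proof.
rewrite /rv_cons mxE; case: splitP => [j|j [/val_inj ->]//].
by rewrite ord1.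
Qed.

Lemma measurable_rv_cons {R : realType} {d} :
  measurable_fun setT (@rv_cons R d).
Proof.
apply: measurable_fun_borelRd => i; case: (unliftP ord0 i) => [j ->|->].
  rewrite (_ : (fun _ => _) = (fun z => (z.1 : 'rV[R]_d) ord0 j)).
    by apply: (measurableT_comp (measurable_coord_borelRd j)).
  by apply/funext => z; rewrite rv_consS.
rewrite (_ : (fun _ => _) = snd); first exact: measurable_snd.
by apply/funext => z; rewrite rv_cons0.
Qed.

Lemma preimage_rv_cons_cbox {R : realType} {d} (a b : 'rV[R]_d.+1) :
  rv_cons @^-1` (cbox a b) =
  cbox (\row_i a ord0 (lift ord0 i)) (\row_i b ord0 (lift ord0 i)) `*`
  `[a ord0 ord0, b ord0 ord0].
Proof.
apply/seteqP; split => z /=.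
  move=> h; split; last by have := h ord0; rewrite rv_cons0 in_itv.
  by move=> i; have := h (lift ord0 i); rewrite rv_consS !mxE.
move=> [h1 h2] i; case: (unliftP ord0 i) => [j ->|->].
  by have := h1 j; rewrite rv_consS !mxE.
by move: h2; rewrite rv_cons0 in_itv.
Qed.

Lemma preimage_rv_cons_cube {R : realType} {d} (M : R) :
  rv_cons @^-1` (cube M : set (borelRd R d.+1)) =
  (cube M : set (borelRd R d)) `*` `[- M, M].
Proof.
rewrite preimage_rv_cons_cbox !mxE; congr (_ `*` _).
by congr cbox; apply/rowP => i; rewrite !mxE.
Qed.

(** Only a measure in dimension [d.+1] is given, and the induction on the dimension must produce the
    one below: the volume of the slab of height 1 over a set. *)
Lemma lebesgue_tail {R : realType} d
    (lam : {measure set (borelRd R d.+1) -> \bar R}) :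
  is_lebesgue_measure lam ->
  exists l : {sigma_finite_measure set (borelRd R d) -> \bar R},
    is_lebesgue_measure l.
Proof.
move=> h.
pose tail (x : borelRd R d.+1) : borelRd R d :=
  \row_i (x : 'rV[R]_d.+1) ord0 (lift ord0 i).
have mtail : measurable_fun setT tail.
  apply: measurable_fun_borelRd => i.
  rewrite (_ : (fun _ => _) = (fun x => (x : 'rV[R]_d.+1) ord0 (lift ord0 i))).
    exact: measurable_coord_borelRd.
  by apply/funext => z; rewrite mxE.
pose S := [set x : borelRd R d.+1 | 0 <= (x : 'rV[R]_d.+1) ord0 ord0 <= 1].
have mS : measurable S.
  have := @measurable_coord_borelRd R d.+1 ord0 measurableT `[0, 1]%classic (measurable_itv _).
  rewrite setTI; set P := _ @^-1` _ => mP.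
  rewrite (_ : S = P)//.
pose l := pushforward (mrestr lam mS) tail.
suff hl : is_lebesgue_measure l.
  have [l' l'E] := @lebesgue_sigma_finite R d l hl.
  by exists l' => a b ab; rewrite l'E; exact: hl.
move=> a b ab; rewrite /l /pushforward /mrestr.
pose a' : 'rV[R]_d.+1 := rv_cons (a : borelRd R d, 0).
pose b' : 'rV[R]_d.+1 := rv_cons (b : borelRd R d, 1).
have ab' i : a' ord0 i <= b' ord0 i.
  case: (unliftP ord0 i) => [j ->|->]; first by rewrite !rv_consS.
  by rewrite !rv_cons0.
have := h a' b' ab'.
rewrite big_ord_recl !rv_cons0 subr0 mul1r => hh.
transitivity (lam (cbox a' b')).
  congr (lam _); apply/seteqP; split => x /=.
    move=> [h1 h2] i; case: (unliftP ord0 i) => [j ->|->].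
      by rewrite !rv_consS; have := h1 j; rewrite mxE.
    by rewrite !rv_cons0.
  move=> h1; split; last by have := h1 ord0; rewrite !rv_cons0.
  by move=> i; have := h1 (lift ord0 i); rewrite !rv_consS mxE.
rewrite hh; congr EFin; apply: eq_bigr => i _.
by rewrite !rv_consS.
Qed.

(** The product measure carried over by [rv_cons] gives boxes their volume, so uniqueness identifies
    it with [lam]. *)
Lemma lebesgue_rv_cons {R : realType} d
    (lam : {measure set (borelRd R d.+1) -> \bar R})
    (l : {sigma_finite_measure set (borelRd R d) -> \bar R}) :
  is_lebesgue_measure lam -> is_lebesgue_measure l ->
  forall A, measurable A ->
    lam A = (l \x @lebesgue_measure R)%E (rv_cons @^-1` A).
Proof.
move=> h hl.
pose m := pushforward (l \x @lebesgue_measure R)%E (@rv_cons R d).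
pose mP := measurable_rv_cons (R := R) (d := d).
suff hm : is_lebesgue_measure m.
  by move=> A mA; rewrite (lebesgue_measure_unique h hm mA).
move=> a b ab; rewrite /m /pushforward.
rewrite -/(cbox a b) preimage_rv_cons_cbox product_measure1E//; last exact: measurable_cbox.
rewrite /= lebesgue_measure_itv/= lte_fin.
rewrite /cbox hl; last by move=> i; rewrite !mxE.
rewrite big_ord_recl mulrC EFinM; congr (_ * _)%E.
  by congr EFin; apply: eq_bigr => i _; rewrite !mxE.
(* The length of an interval is given by cases on strict order of its endpoints; a side of length
   zero is handled separately. *)
have := ab ord0; rewrite le_eqVlt => /predU1P[->|->]; last by [].
by rewrite ltxx subrr.
Qed.

Lemma integral_cube_rv_cons {R : realType} d
    (lam : {measure set (borelRd R d.+1) -> \bar R})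
    (l : {sigma_finite_measure set (borelRd R d) -> \bar R}) (M : R)
    (f : borelRd R d.+1 -> \bar R) :
  is_lebesgue_measure lam -> is_lebesgue_measure l ->
  measurable_fun setT f -> (forall x, 0 <= f x)%E ->
  (\int[lam]_(x in cube M) f x =
   \int[l]_(x in cube M) \int[lebesgue_measure]_(s in `[(- M)%R, M]) f (rv_cons (x, s)))%E.
Proof.
move=> h hl mf f0.
have mg : measurable_fun setT (f \_ (cube M)).
  apply: (measurable_restrictT f (measurable_cube M)).1.
  exact: measurable_funTS.
have g0 x : (0 <= (f \_ (cube M)) x)%E by rewrite patchE; case: ifP.
rewrite integral_mkcond.
have mP := @measurable_rv_cons R d.
transitivity (\int[pushforward (l \x @lebesgue_measure R)%E (@rv_cons R d)]_x
    (f \_ (cube M)) x)%E.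
  by apply: eq_measure_integral => A mA _; rewrite (lebesgue_rv_cons h hl mA).
etransitivity.
  by apply: (ge0_integral_pushforward mP (l \x @lebesgue_measure R)%E measurableT mg).
rewrite preimage_setT.
etransitivity.
  apply: (fubini_tonelli1 (m1 := l) (m2 := @lebesgue_measure R)).
    exact: measurableT_comp.
  by move=> z; exact: g0.
rewrite [RHS]integral_mkcond; apply: eq_integral => x _.
have memE s : ((rv_cons (x, s) : borelRd R d.+1) \in cube M) = (x \in cube M) && (s \in `[- M, M]%classic).
  have := preimage_rv_cons_cube (R := R) (d := d) M => /seteqP[h1 h2].
  apply/idP/andP; first by rewrite !inE => /h1[].
  by rewrite !inE => -[? ?]; exact: h2.
rewrite patchE /fubini_F; case: ifPn => xM.
  rewrite [RHS]integral_mkcond; apply: eq_integral => s _.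
  by rewrite /= !patchE memE xM.
by rewrite integral0_eq// => s _; rewrite /= patchE memE (negbTE xM).
Qed.

(** * The sharp Young inequality in dimension d *)

Lemma lipschitz_continuous {R : realType} (L : R) (f : R -> R) :
  (forall s t, `|f s - f t| <= L * `|s - t|) -> continuous f.
Proof.
move=> fL s; apply/cvgrPdist_lt => e e0.
have L1 : 0 < `|L| + 1 by rewrite ltr_wpDl.
near=> t.
apply: (le_lt_trans (fL s t)).
apply: (@le_lt_trans _ _ ((`|L| + 1) * `|s - t|)).
  by rewrite ler_wpM2r// (le_trans (ler_norm L))// lerDl.
rewrite mulrC -ltr_pdivlMr//; near: t.
by apply: cvgr_dist_lt; rewrite ?divr_gt0//; exact: cvg_id.
Unshelve. all: by end_near. Qed.

(* Lipschitz with respect to the sup norm, stated so that it also makes sense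
   in dimension 0. *)
Definition rv_lipschitz {R : realType} d (f : 'rV[R]_d -> R) :=
  exists2 L : R, 0 <= L & forall (x y : 'rV[R]_d) (D : R), 0 <= D ->
    (forall i, `|x ord0 i - y ord0 i| <= D) -> `|f x - f y| <= L * D.

Lemma rv_lipschitz_continuous {R : realType} d (f : 'rV[R]_d -> R) :
  rv_lipschitz f -> continuous f.
Proof.
move=> [L L0 fL] x; apply/(@cvgrPdist_le _ _ _ (nbhs x)) => e e0.
have L1 : 0 < L + 1 by rewrite ltr_wpDl.
have d0 : 0 < e / (L + 1) by rewrite divr_gt0.
near=> y.
have : ball x (e / (L + 1)) y by near: y; exact: nbhsx_ballx.
move=> [_ xy]; rewrite (le_trans (fL x y (e / (L + 1)) (ltW d0) _))//.
  by move=> i; exact: ltW (xy ord0 i).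
by rewrite mulrCA ger_pMr// ler_pdivrMr// mul1r lerDl.
Unshelve. all: by end_near. Qed.

Lemma rv_lipschitz_slice {R : realType} d (f : 'rV[R]_d.+1 -> R)
    (x : borelRd R d) :
  rv_lipschitz f -> continuous (fun s : R => f (rv_cons (x, s))).
Proof.
move=> [L L0 fL]; apply: (@lipschitz_continuous R L) => s t.
apply: fL => // i; case: (unliftP ord0 i) => [j ->|->].
  by rewrite !rv_consS subrr normr0.
by rewrite !rv_cons0.
Qed.

Definition marginal {R : realType} d (M : R) (f : 'rV[R]_d.+1 -> R) :
    'rV[R]_d -> R :=
  fun x => \int[lebesgue_measure]_(s in `[- M, M]) f (rv_cons (x, s)).

Lemma Rintegral_itv_cst {R : realType} (M r : R) : 0 <= M ->
  \int[lebesgue_measure]_(s in `[- M, M]) r = 2 * M * r.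
Proof.
move=> M0; rewrite Rintegral_cst//= lebesgue_measure_itv/= lte_fin.
have [MM|] := ltP (- M) M; first by rewrite /= opprK mulrC; congr (_ * _); ring.
by move=> MM; rewrite (_ : M = 0) ?mulr0 ?mul0r//; lra.
Qed.

(** Integration over an interval of length [2 * M] multiplies the Lipschitz constant by that
    length. *)
Lemma marginal_lipschitz {R : realType} d (M : R) (f : 'rV[R]_d.+1 -> R) :
  0 <= M -> rv_lipschitz f -> rv_lipschitz (marginal M f).
Proof.
move=> M0 fl; have [L L0 fL] := fl.
exists (2 * M * L); first by rewrite !mulr_ge0.
move=> x y D D0 xy; rewrite /marginal.
have int z := continuous_integrable_itv (- M) M (@rv_lipschitz_slice R d f z fl).
rewrite -RintegralB//.
have intB : (@lebesgue_measure R).-integrable `[- M, M]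
    (EFin \o (fun s => f (rv_cons (x, s)) - f (rv_cons (y, s)))).
  apply: continuous_integrable_itv => s.
  by apply: cvgB; exact: rv_lipschitz_slice.
apply: (le_trans (le_normr_Rintegral _ intB)) => //.
rewrite -mulrA -(Rintegral_itv_cst _ M0); apply: le_Rintegral => //.
- exact: (integrable_norm intB).
- by apply: continuous_integrable_itv => s; exact: cvg_cst.
- move=> s _; apply: fL => // i; case: (unliftP ord0 i) => [j ->|->].
    by rewrite !rv_consS.
  by rewrite !rv_cons0 subrr normr0.
Qed.

(** The uniform positive lower bound that the transports demand survives each integration, with a
    new constant. *)
Lemma marginal_ge {R : realType} d (M e : R) (f : 'rV[R]_d.+1 -> R) :
  0 <= M -> rv_lipschitz f -> (forall x, e <= f x) ->
  forall x, 2 * M * e <= marginal M f x.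
Proof.
move=> M0 fl fe x; rewrite -Rintegral_itv_cst//; apply: le_Rintegral => //.
- by apply: continuous_integrable_itv => s; exact: cvg_cst.
- by apply: continuous_integrable_itv; exact: rv_lipschitz_slice.
Qed.

Lemma EFin_marginal {R : realType} d (M : R) (f : 'rV[R]_d.+1 -> R)
    (x : borelRd R d) : rv_lipschitz f ->
  (marginal M f x)%:E =
  (\int[lebesgue_measure]_(s in `[(- M)%R, M]) (f (rv_cons (x, s)))%:E)%E.
Proof.
move=> fl; rewrite /marginal /Rintegral fineK//.
apply: integrable_fin_num => //; apply: continuous_integrable_itv.
exact: rv_lipschitz_slice.
Qed.

Lemma rv_consB {R : realType} d (x y : borelRd R d) (s t : R) :
  (rv_cons (x, s) : 'rV[R]_d.+1) - rv_cons (y, t) =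
  rv_cons ((x : 'rV[R]_d) - y : borelRd R d, s - t).
Proof.
apply/rowP => i; rewrite [LHS]mxE [X in _ + X]mxE.
case: (unliftP ord0 i) => [j ->|->].
  by rewrite !rv_consS !mxE.
by rewrite !rv_cons0.
Qed.

Lemma measurable_integral_section d1 d2 (T1 : measurableType d1)
    (T2 : measurableType d2) (R : realType)
    (m2 : {sigma_finite_measure set T2 -> \bar R}) (B : set T2)
    (f : T1 * T2 -> \bar R) :
  measurable B -> measurable_fun [set: T1 * T2] f -> (forall z, 0 <= f z)%E ->
  measurable_fun [set: T1] (fun x => \int[m2]_(y in B) f (x, y))%E.
Proof.
move=> mB mf f0.
pose g := f \_ (setT `*` B).
have mg : measurable_fun [set: T1 * T2] g.
  apply: (measurable_restrictT f (measurableX measurableT mB)).1.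
  exact: measurable_funTS.
have g0 z : (0 <= g z)%E by rewrite /g patchE; case: ifP.
rewrite (_ : (fun _ => _) = fubini_F m2 g).
  exact: measurable_fun_fubini_tonelli_F.
apply/funext => x; rewrite /fubini_F [LHS]integral_mkcond; apply: eq_integral => y _.
by rewrite /g !patchE in_setX in_setT.
Qed.

Lemma measurable_young_integrand {R : realType} d d' (T : measurableType d')
    (a : R) (f g h : 'rV[R]_d -> R) (u v : T -> borelRd R d) :
  rv_lipschitz f -> rv_lipschitz g -> rv_lipschitz h ->
  measurable_fun setT u -> measurable_fun setT v ->
  measurable_fun setT (fun z => (f (u z) `^ a * g (v z) `^ a *
    h ((u z : 'rV[R]_d) - v z) `^ (2 - 2 * a))%:E).
Proof.
move=> fl gl hl mu mv.
have mlip (k : 'rV[R]_d -> R) (w : T -> borelRd R d) : rv_lipschitz k -> measurable_fun [set: T] w ->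
    measurable_fun setT (fun z => k (w z)).
  move=> kl mw.
  apply: (@measurableT_comp _ _ _ _ _ _ (k : borelRd R d -> R) _ w); last exact: mw.
  by apply: continuous_measurable_borelRd; exact: rv_lipschitz_continuous.
apply/measurable_EFinP; apply: measurable_funM; [apply: measurable_funM|];
  apply: measurable_fun_powR; apply: mlip => //.
apply: measurable_fun_borelRd => i.
rewrite (_ : (fun _ => _) = (fun z => (u z : 'rV[R]_d) ord0 i - (v z : 'rV[R]_d) ord0 i)).
  by apply: measurable_funB; apply: (measurableT_comp (measurable_coord_borelRd i)).
by apply/funext => z; rewrite !mxE.
Qed.

Lemma Rintegral_cube_marginal {R : realType} d
    (lam : {measure set (borelRd R d.+1) -> \bar R})
    (l : {sigma_finite_measure set (borelRd R d) -> \bar R}) (M : R)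
    (f : 'rV[R]_d.+1 -> R) :
  is_lebesgue_measure lam -> is_lebesgue_measure l ->
  rv_lipschitz f -> (forall x, 0 <= f x) ->
  \int[l]_(x in cube M) marginal M f x = \int[lam]_(x in cube M) f x.
Proof.
move=> h hl fl f0; rewrite /Rintegral; congr fine.
rewrite (integral_cube_rv_cons _ h hl)//.
- by apply: eq_integral => x _; rewrite EFin_marginal.
- apply/measurable_EFinP; apply: continuous_measurable_borelRd.
  exact: rv_lipschitz_continuous.
Qed.

Lemma eq_fun_rV0 {R : realType} (f : 'rV[R]_0 -> R) x y : f x = f y.
Proof. by congr f; apply/rowP => -[]. Qed.

(** With the tails of [x] and [y] fixed, the inequality on the line bounds the integral over both
    heads by [young_const a] times the same integrand for the marginals, to which the induction
    hypothesis applies. *)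
Lemma young_space {R : realType} (a : R) : 1 < 2 * a -> a < 1 ->
  forall d (lam : {sigma_finite_measure set (borelRd R d) -> \bar R}) (M e : R)
    (f g h : 'rV[R]_d -> R),
  is_lebesgue_measure lam -> 0 < M -> 0 < e ->
  rv_lipschitz f -> rv_lipschitz g -> rv_lipschitz h ->
  (forall x, e <= f x) -> (forall x, e <= g x) -> (forall x, e <= h x) ->
  (\int[lam]_(y in cube M) \int[lam]_(x in cube M)
      (f x `^ a * g y `^ a * h ((x : 'rV[R]_d) - y) `^ (2 - 2 * a))%:E <=
   (young_const a ^+ d *
    ((\int[lam]_(x in cube M) f x)%R `^ a *
     (\int[lam]_(x in cube M) g x)%R `^ a *
     (\int[lam]_(x in cube (2 * M)) h x)%R `^ (2 - 2 * a)))%:E)%E.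
Proof.
move=> a1 a1'; elim=> [|d IH] lam M e f g h hlam M0 e0 fl gl hl fe ge he.
  (* In dimension 0 the space is one point, of measure 1 as an empty product, and both sides are the
     same number. *)
  have cubeT N : 0 <= N -> lam (cube N) = 1%E.
    by move=> N0; rewrite /cube /cbox hlam ?big_ord0// => -[].
  have f0 x : 0 <= f x by exact: le_trans (ltW e0) (fe x).
  have g0 x : 0 <= g x by exact: le_trans (ltW e0) (ge x).
  have h0 x : 0 <= h x by exact: le_trans (ltW e0) (he x).
  have I0 (k : 'rV[R]_0 -> R) N : 0 <= N -> \int[lam]_(x in cube N) k x = k 0.
    move=> N0; rewrite (eq_Rintegral _ (g := cst (k 0))).
      by rewrite Rintegral_cst; [rewrite /= cubeT//= mulr1|exact: measurable_cube].
    by move=> x _; exact: eq_fun_rV0.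
  rewrite !I0 ?mulr_ge0 ?(ltW M0)// expr0 mul1r.
  under eq_integral => y _.
    under eq_integral => x _.
      rewrite (eq_fun_rV0 f _ 0) (eq_fun_rV0 g _ 0) (eq_fun_rV0 h _ 0).
      over.
    rewrite integral_cst; [rewrite /= cubeT ?mule1 ?(ltW M0)//|exact: measurable_cube].
    over.
  by rewrite integral_cst; [rewrite /= cubeT ?mule1 ?(ltW M0)|exact: measurable_cube].
have f0 x : 0 <= f x by exact: le_trans (ltW e0) (fe x).
have g0 x : 0 <= g x by exact: le_trans (ltW e0) (ge x).
have h0 x : 0 <= h x by exact: le_trans (ltW e0) (he x).
have [l hl'] := lebesgue_tail hlam.
have M2 : 0 <= 2 * M by rewrite mulr_ge0// ltW.
have M0' := ltW M0.
pose P (x y : borelRd R d.+1) :=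
  (f x `^ a * g y `^ a * h ((x : 'rV[R]_d.+1) - y) `^ (2 - 2 * a))%:E.
have P0 x y : (0 <= P x y)%E by rewrite lee_fin !mulr_ge0// powR_ge0.
have mP d' (T : measurableType d') (u v : T -> borelRd R d.+1) :
    measurable_fun setT u -> measurable_fun setT v ->
    measurable_fun setT (fun z => P (u z) (v z)).
  by move=> mu mv; exact: measurable_young_integrand.
have mJ : measurable_fun setT (fun y => \int[lam]_(x in cube M) P x y)%E.
  apply: (@measurable_integral_section _ _ _ _ R lam _ (fun z => P z.2 z.1)) => //.
    exact: measurable_cube.
  exact: mP.
rewrite (integral_cube_rv_cons _ hlam hl' mJ); last first.
  by move=> y; apply: integral_ge0.
pose G y (z : measurableTypeR R * borelRd R d) :=
  (\int[lebesgue_measure]_(s in `[(- M)%R, M])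
     P (rv_cons (z.2, s)) (rv_cons (y, z.1)))%E.
have mG y : measurable_fun setT (G y).
  apply: (@measurable_integral_section _ _ _ (measurableTypeR R) R (@lebesgue_measure R) _
    (fun w : (measurableTypeR R * borelRd R d) * measurableTypeR R =>
      P (rv_cons (w.1.2, w.2)) (rv_cons (y, w.1.1)))) => //.
  have m1 : measurable_fun [set: (measurableTypeR R * borelRd R d) * measurableTypeR R] fst.
    exact: measurable_fst.
  apply: mP; apply: (measurableT_comp measurable_rv_cons).
    apply: measurable_fun_pair; last exact: measurable_snd.
    by apply: measurableT_comp m1; exact: measurable_snd.
  apply: measurable_fun_pair; first exact: measurable_cst.
  by apply: measurableT_comp m1; exact: measurable_fst.
(* The integral over the head [t] of [y] is moved inside the one over the tail of [x], so that both
   heads are innermost. *)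
have swap y : (\int[lebesgue_measure]_(t in `[(- M)%R, M])
      \int[lam]_(x in cube M) P x (rv_cons (y, t)) =
    \int[l]_(x in cube M) \int[lebesgue_measure]_(t in `[(- M)%R, M]) G y (t, x))%E.
  under eq_integral => t _.
    rewrite (integral_cube_rv_cons _ hlam hl')//; last first.
      by apply: mP => //; exact: measurable_cst.
    over.
  apply: (@tonelli_rectangle _ _ _ _ R (@lebesgue_measure R) l `[(- M)%R, M]%classic (cube M) (G y)) => //.
  - exact: measurable_cube.
  - by move=> z; exact: integral_ge0.
under eq_integral do rewrite swap.
set C := young_const a.
pose Q (x y : borelRd R d) := (marginal M f x `^ a * marginal M g y `^ a *
  marginal (2 * M) h ((x : 'rV[R]_d) - y) `^ (2 - 2 * a))%:E.
have Q0 x y : (0 <= Q x y)%E by rewrite lee_fin !mulr_ge0// powR_ge0.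
have C0 : 0 <= C by rewrite /C /young_const !mulr_ge0 ?powR_ge0 ?sqrtr_ge0.
apply: (@le_trans _ _ (\int[l]_(y in cube M) \int[l]_(x in cube M) (C%:E * Q x y))%E).
  apply: le_integral_ge0 => [y _|y _].
    by do 3!(apply: integral_ge0 => ? _).
  apply: le_integral_ge0 => [x _|x _].
    by do 2!(apply: integral_ge0 => ? _).
  (* [rv_cons] commutes with subtraction, so at fixed tails the third function depends on the heads
     through [s - t] only. *)
  have YL := @young_line R a M e (fun s => f (rv_cons (x, s)))
    (fun s => g (rv_cons (y, s)))
    (fun s => h (rv_cons ((x : 'rV[R]_d) - y : borelRd R d, s))) a1 a1' M0 e0
    (fun=> fe _) (fun=> ge _) (fun=> he _) (rv_lipschitz_slice fl)
    (rv_lipschitz_slice gl) (rv_lipschitz_slice hl).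
  rewrite -EFinM; apply: le_trans YL.
  apply: le_integral_ge0 => [t _|t _]; first exact: integral_ge0.
  apply: le_integral_ge0 => [s _|s _]; first exact: P0.
  by rewrite /P rv_consB.
have fl' := marginal_lipschitz M0' fl.
have gl' := marginal_lipschitz M0' gl.
have hl2 := marginal_lipschitz M2 hl.
have mQ d' (T : measurableType d') (u v : T -> borelRd R d) :
    measurable_fun setT u -> measurable_fun setT v ->
    measurable_fun setT (fun z => Q (u z) (v z)).
  by move=> mu mv; exact: measurable_young_integrand.
under eq_integral => y _.
  rewrite ge0_integralZl_EFin//; last 2 first.
  - exact: measurable_cube.
  - by apply: measurable_funTS; apply: mQ => //; exact: measurable_cst.
  over.
rewrite ge0_integralZl_EFin//; last 3 first.
- exact: measurable_cube.
- by move=> y _; exact: integral_ge0.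
- apply: measurable_funTS.
  apply: (@measurable_integral_section _ _ _ _ R l _ (fun z => Q z.2 z.1)) => //.
    exact: measurable_cube.
  exact: mQ.
rewrite exprS -mulrA (EFinM C) lee_wpmul2l ?lee_fin//.
have e2 : 0 < 2 * M * e by rewrite !mulr_gt0.
have := IH l M (2 * M * e) (marginal M f) (marginal M g) (marginal (2 * M) h) hl' M0 e2 fl' gl' hl2.
rewrite !(Rintegral_cube_marginal _ hlam hl')//; apply.
- exact: marginal_ge.
- exact: marginal_ge.
(* The marginal of [h] over the doubled interval is at least [4 * M * e], hence above the common
   bound [2 * M * e]. *)
- move=> x; apply: le_trans (marginal_ge M2 hl he x).
  by rewrite ler_wpM2r ?(ltW e0)// ler_wpM2l//; lra.
Qed.

(** * From Young to the distance distribution *)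

(** In terms of [s] one has [2 * a = 1 + s] and [t ^+ 2 = 4 * s / (1 + s)]. Every factor is then a
    power of 2, [pi], [s] or [1 + s]; the powers of [pi] cancel and 2 sqrt s / (1 + s) remains. *)
Lemma young_const_expr {R : realType} (t : R) : 0 < t -> t < Num.sqrt 2 ->
  let a := (1 + t ^+ 2 / (4 - t ^+ 2)) / 2 in
  [/\ 1 < 2 * a, a < 1 &
    young_const a * t `^ (2 - 2 * a) = Num.sqrt (t ^+ 2 * (4 - t ^+ 2) / 4)].
Proof.
move=> t0 t2 a.
have tt : t ^+ 2 < 2.
  by rewrite -[ltRHS](@sqr_sqrtr R 2)// !expr2 ltr_pM// ltW.
have tt0 : 0 < t ^+ 2 by rewrite exprn_gt0.
pose s := t ^+ 2 / (4 - t ^+ 2).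
have s0 : 0 < s by rewrite divr_gt0//; lra.
have s1 : s < 1 by rewrite ltr_pdivrMr//; lra.
have aE : 2 * a = 1 + s by rewrite /a -/s; lra.
split; [lra|lra|].
have tE : t ^+ 2 = 4 * s / (1 + s).
  by rewrite /s; field; apply/andP; split; lra.
have X : t ^+ 2 * (4 - t ^+ 2) / 4 = 4 * s / ((1 + s) * (1 + s)).
  by rewrite tE; field; lra.
rewrite X.
have tE' : t = (4 * s / (1 + s)) `^ 2^-1.
  by rewrite -tE powR12_sqrt ?sqr_ge0// sqrtr_sqr gtr0_norm.
have -> : t `^ (2 - 2 * a) = ((4 * s / (1 + s)) `^ 2^-1) `^ (2 - 2 * a) by rewrite -tE'.
rewrite /young_const /gauss_dual_mass.
have p0 : 0 < pi :> R by exact: pi_gt0.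
have s1' : 0 < 1 + s by lra.
have -> : pi / (a / 2) = 4 * pi / (1 + s).
  by rewrite -aE; field; lra.
have -> : pi / (2 * a / (2 * a - 1)) = pi * s / (1 + s).
  by rewrite aE; field; apply/andP; split; lra.
have q1 : 0 <= 4 * s / ((1 + s) * (1 + s)).
  by apply: divr_ge0; apply: mulr_ge0 => //; exact: ltW.
have q2 : 0 <= 4 * pi / (1 + s).
  by apply: divr_ge0; [apply: mulr_ge0 => //|]; exact: ltW.
have q3 : 0 <= pi * s / (1 + s).
  by apply: divr_ge0; [apply: mulr_ge0|]; exact: ltW.
rewrite -(powR12_sqrt q1) -(powR12_sqrt q2) -(powR12_sqrt q3) -(powR12_sqrt (ltW p0)).
rewrite aE.
have ln4 : ln (4 : R) = 2 * ln 2.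
  by rewrite (_ : 4 = 2 * 2) ?lnM ?posrE//; ring.
have u0 : 0 < 4 - t ^+ 2 by lra.
(* Logarithms turn the identity between powers with exponents in [s] into one that is linear in the
   logarithms of 2, [pi], [s] and [1 + s]. *)
apply: ln_inj; rewrite ?posrE ?mulr_gt0 ?powR_gt0 ?divr_gt0 ?mulr_gt0 ?invr_gt0 ?powR_gt0//.
have lnD x y : 0 < x -> 0 < y -> ln (x / y) = ln x - ln y :> R.
  by move=> x0 y0; rewrite lnM ?posrE ?invr_gt0// lnV ?posrE.
have lnX x y : 0 < x -> 0 < y -> ln (x * y) = ln x + ln y :> R.
  by move=> x0 y0; rewrite lnM ?posrE.
have pos4 : 0 < 4 :> R by [].
rewrite !(lnX, lnD, ln_powR, lnV, ln4) ?posrE ?mulr_gt0 ?powR_gt0 ?divr_gt0 ?mulr_gt0 ?invr_gt0 ?powR_gt0//.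
  by field.
exact: mulr_gt0.
Qed.

(** Uniqueness again: the image of [lam] under division by [r], multiplied by [r ^- d], gives boxes
    their volume. *)
Lemma lebesgue_scale {R : realType} d (lam : {measure set (borelRd R d) -> \bar R})
    (r : R) (A : set (borelRd R d)) :
  is_lebesgue_measure lam -> 0 < r -> measurable A ->
  lam ((fun x : borelRd R d => (r^-1 *: (x : 'rV[R]_d) : borelRd R d)) @^-1` A) =
  ((r ^+ d)%:E * lam A)%E.
Proof.
move=> h r0 mA.
pose phi (x : borelRd R d) : borelRd R d := r^-1 *: (x : 'rV[R]_d).
have mphi : measurable_fun setT phi.
  apply: measurable_fun_borelRd => i.
  rewrite (_ : (fun _ => _) = (fun x => r^-1 * (x : 'rV[R]_d) ord0 i)).
    by apply: measurable_funM => //; exact: measurable_coord_borelRd.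
  by apply/funext => x; rewrite mxE.
have k0 : 0 <= (r ^+ d)^-1 by rewrite invr_ge0 exprn_ge0// ltW.
pose m0 := mscale (NngNum k0) (pushforward lam phi).
pose m := m0 mphi.
suff hm : is_lebesgue_measure m.
  rewrite -(lebesgue_measure_unique hm h mA) /m /m0 /mscale/= muleA -EFinM mulfV ?mul1e//.
  by rewrite expf_neq0// gt_eqF.
move=> a b ab; rewrite /m /m0 /mscale/= /pushforward.
have := h (r *: a) (r *: b).
rewrite (_ : [set x | _] = phi @^-1` cbox a b) => [->|].
- rewrite -EFinM; congr EFin.
  rewrite (eq_bigr (fun i => r * (b ord0 i - a ord0 i))); last first.
    by move=> i _; rewrite !mxE mulrBr.
  by rewrite big_split/= prodr_const card_ord mulrA mulVf ?mul1r// expf_neq0// gt_eqF.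
- by move=> i; rewrite !mxE ler_pM2l.
- apply/seteqP; split => x /= xab i; have := xab i; rewrite /phi !mxE;
    by rewrite ler_pdivlMl// ler_pdivrMl.
Qed.

(** * Lipschitz majorants of the indicator of a closed set *)

Section bump.
Context {R : realType} {d : nat} (A : set 'rV[R]_d).
Hypothesis A0 : A !=set0.
Implicit Types (x y k : 'rV[R]_d).

(** The distance to [A] in the sup norm. The condition [0 <= D] keeps the set bounded below in
    dimension 0 as well, where the condition on coordinates is empty. *)
Definition sup_dist x : R :=
  inf [set D : R | 0 <= D /\ exists2 k, A k & forall i, `|x ord0 i - k ord0 i| <= D].

Let lb x : has_lbound [set D : R | 0 <= D /\ exists2 k, A k &
  forall i, `|x ord0 i - k ord0 i| <= D].
Proof. by exists 0 => D []. Qed.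

Let ne x : [set D : R | 0 <= D /\ exists2 k, A k &
  forall i, `|x ord0 i - k ord0 i| <= D] !=set0.
Proof.
have [k Ak] := A0; exists (\sum_i `|x ord0 i - k ord0 i|); split.
  by rewrite sumr_ge0.
by exists k => // i; rewrite (bigD1 i)//= lerDl sumr_ge0.
Qed.

Lemma sup_dist_ge0 x : 0 <= sup_dist x.
Proof. by apply: lb_le_inf => // D []. Qed.

Lemma sup_dist_mem x : A x -> sup_dist x = 0.
Proof.
move=> Ax; apply/eqP; rewrite eq_le sup_dist_ge0 andbT; apply: ge_inf => //.
by split => //; exists x => // i; rewrite subrr normr0.
Qed.

Lemma sup_dist_gt0 x : closed A -> ~ A x -> 0 < sup_dist x.
Proof.
move=> cA nAx.
have : nbhs x (~` A) by apply: open_nbhs_nbhs; split => //; rewrite openC.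
move=> /nbhs_ballP[e /= e0 xe]; apply: (lt_le_trans e0).
apply: lb_le_inf => // D [D0 [k Ak xk]]; rewrite leNgt; apply/negP => De.
apply: (xe k) => //; split => // i j; rewrite ord1.
exact: le_lt_trans (xk j) De.
Qed.

Lemma sup_dist_le x y (D : R) : 0 <= D ->
  (forall i, `|x ord0 i - y ord0 i| <= D) -> sup_dist x <= sup_dist y + D.
Proof.
move=> D0 xy; rewrite -lerBlDr; apply: lb_le_inf => // E [E0 [k Ak yk]].
rewrite lerBlDr; apply: ge_inf => //; split; first by rewrite addr_ge0.
exists k => // i; rewrite -(subrK (y ord0 i) (x ord0 i)) -addrA.
by rewrite (le_trans (ler_normD _ _))// [leRHS]addrC lerD.
Qed.

(** A tent over [A] whose slope grows with [n], raised by a vanishing constant that provides the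
    uniform positive lower bound required by [young_space]. *)
Definition bump (n : nat) x : R :=
  Num.max 0 (1 - n.+1%:R * sup_dist x) + n.+1%:R^-1.

Lemma bump_lipschitz n : rv_lipschitz (bump n).
Proof.
exists n.+1%:R => // x y D D0 xy; rewrite /bump opprD addrACA subrr addr0.
have h1 := sup_dist_le D0 xy.
have {}h2 : sup_dist y <= sup_dist x + D.
  by apply: sup_dist_le => // i; rewrite distrC.
set N : R := n.+1%:R; have N0 : 0 < N by exact: ltr0Sn.
have g1 : N * sup_dist x <= N * sup_dist y + N * D by rewrite -mulrDr ler_pM2l.
have g2 : N * sup_dist y <= N * sup_dist x + N * D by rewrite -mulrDr ler_pM2l.
have ND : 0 <= N * D by rewrite mulr_ge0// ltW.
case: (leP 0 (1 - N * sup_dist x)) => ?; case: (leP 0 (1 - N * sup_dist y)) => ?;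
  rewrite ler_norml; apply/andP; split; lra.
Qed.

Lemma bump_ge n x : n.+1%:R^-1 <= bump n x.
Proof. by rewrite /bump lerDr le_max lexx. Qed.

Lemma bump_ge1 n x : A x -> 1 <= bump n x.
Proof.
move=> Ax; rewrite /bump sup_dist_mem// mulr0 subr0.
by rewrite (le_trans (_ : 1 <= Num.max 0 1)) ?le_max ?lexx ?orbT// lerDl.
Qed.

Lemma bump_le2 n x : bump n x <= 2.
Proof.
rewrite /bump (_ : 2 = 1 + 1)// lerD//; last by rewrite invf_le1// ler1n.
by rewrite ge_max ler01 gerBl mulr_ge0// sup_dist_ge0.
Qed.

Lemma bump_cvg x : closed A -> bump n x @[n --> \oo] --> (\1_A x : R).
Proof.
move=> cA; rewrite -[\1_A x]addr0; apply: cvgD; last exact: cvg_harmonic.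
rewrite indicE; have [Ax|nAx] := pselect (A x).
  rewrite mem_set// sup_dist_mem//.
  under eq_fun do rewrite mulr0 subr0.
  by rewrite (_ : Num.max 0 1 = 1); [exact: cvg_cst|exact/max_idPr].
rewrite memNset//.
have s0 := sup_dist_gt0 cA nAx.
apply: cvg_near_cst; near=> n; apply/max_idPl.
rewrite subr_le0 -ler_pdivrMr// mul1r.
apply: (@le_trans _ _ n%:R); last by rewrite ler_nat.
by near: n; exact: nbhs_infty_ger.
Unshelve. all: by end_near. Qed.

(** Dominated convergence on the cube, with the constant 2 as dominating function. *)
Lemma integral_bump_cvg (lam : {measure set (borelRd R d) -> \bar R}) (M : R) :
  is_lebesgue_measure lam -> closed A ->
  \int[lam]_(x in cube M) bump n x @[n --> \oo] -->
  fine (lam ((A : set (borelRd R d)) `&` cube M)).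
Proof.
move=> h cA.
have mA : measurable (A : set (borelRd R d)) by exact: closed_measurable_borelRd.
have mC := measurable_cube (R := R) (d := d) M.
have fA : (lam ((A : set (borelRd R d)) `&` cube M) < +oo)%E.
  apply: le_lt_trans (lebesgue_cube_lty M h).
  by apply: le_measure => //; rewrite inE//; exact: measurableI.
apply: fine_cvg; rewrite fineK ?ge0_fin_numE//.
rewrite -integral_indic//.
apply: (@dominated_cvg _ _ _ _ _ mC _ _ (cst 2%:E)) => //.
- move=> n; apply/measurable_EFinP/measurable_funTS.
  apply: continuous_measurable_borelRd.
  exact: rv_lipschitz_continuous (bump_lipschitz n).
- move=> x _; apply: cvg_EFin; first exact: nearW.
  exact: bump_cvg.
- apply/integrableP; split; first exact: measurable_cst.
  rewrite integral_cst// lte_mul_pinfty//; exact: lebesgue_cube_lty.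
- move=> n x _; rewrite abse_EFin lee_fin ger0_norm ?bump_le2//.
  by apply: le_trans (bump_ge n x); rewrite invr_ge0.
Qed.

End bump.

(** Young's inequality for three indicators, with [T] in the role of tK. It holds for the bumps, and
    the bumps tend to the indicators; positive volumes make the powers continuous at the limit. *)
Lemma pair_volume_le {R : realType} d
    (lam : {sigma_finite_measure set (borelRd R d) -> \bar R}) (a M : R)
    (K T : set 'rV[R]_d) :
  1 < 2 * a -> a < 1 -> 0 < M -> is_lebesgue_measure lam ->
  closed K -> K !=set0 -> closed T -> T !=set0 ->
  (K : set (borelRd R d)) `<=` cube M ->
  (0 < lam (K : set (borelRd R d)))%E ->
  (0 < lam ((T : set (borelRd R d)) `&` cube (2 * M)))%E ->
  (\int[lam]_(x in K) lam [set y : borelRd R d | K y /\ T ((x : 'rV[R]_d) - y)%R] <=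
   (young_const a ^+ d * (fine (lam (K : set (borelRd R d))) `^ a *
     fine (lam (K : set (borelRd R d))) `^ a *
     fine (lam ((T : set (borelRd R d)) `&` cube (2 * M))) `^ (2 - 2 * a)))%:E)%E.
Proof.
move=> a1 a1' M0 h cK K0 cT T0 KM lK lT.
set v := fine (lam K); set w := fine (lam (_ `&` _)).
have mK : measurable (K : set (borelRd R d)) by exact: closed_measurable_borelRd.
have mT : measurable (T : set (borelRd R d)) by exact: closed_measurable_borelRd.
have mC (N : R) : measurable (cube N : set (borelRd R d)) by exact: measurable_cube.
have v0 : 0 < v.
  rewrite fine_gt0// lK/= (le_lt_trans _ (lebesgue_cube_lty M h))//.
  by apply: le_measure => //; rewrite inE.
have w0 : 0 < w.
  rewrite fine_gt0// lT/= (le_lt_trans _ (lebesgue_cube_lty (2 * M) h))//.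
  by apply: le_measure => //; rewrite inE//; exact: measurableI.
set L := (X in (X <= _)%E).
pose I n := \int[lam]_(x in cube M) bump K n x.
pose J n := \int[lam]_(x in cube (2 * M)) bump T n x.
pose B n := young_const a ^+ d * (I n `^ a * I n `^ a * J n `^ (2 - 2 * a)).
have LB n : (L <= (B n)%:E)%E.
  pose e : R := n.+1%:R^-1.
  have e0 : 0 < e by rewrite invr_gt0.
  have bK0 x : 0 <= bump K n x by apply: le_trans (bump_ge K n x); exact: ltW.
  have bT0 x : 0 <= bump T n x by apply: le_trans (bump_ge T n x); exact: ltW.
  pose P (x y : borelRd R d) := (bump K n x `^ a * bump K n y `^ a *
    bump T n ((x : 'rV[R]_d) - y) `^ (2 - 2 * a))%:E.
  have P0 x y : (0 <= P x y)%E by rewrite lee_fin !mulr_ge0// powR_ge0.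
  have mP : measurable_fun setT (fun z : borelRd R d * borelRd R d => P z.1 z.2).
    by apply: measurable_young_integrand => //; exact: bump_lipschitz.
  (* Where [x] and [y] lie in [K] and [x - y] in [T], all three bumps are at least 1, and so are
     their powers, since the exponents are nonnegative. *)
  apply: (@le_trans _ _ (\int[lam]_(x in cube M) \int[lam]_(y in cube M) P x y)%E).
    rewrite /L integral_mkcond [leRHS]integral_mkcond.
    apply: le_integral_ge0 => [x _|x _]; rewrite patchE; case: ifPn => // xK; last first.
      by rewrite patchE; case: ifP => // _; exact: integral_ge0.
    have Kx : K x by rewrite inE in xK.
    rewrite patchE mem_set; last exact: KM.
    set Y := [set y | _].
    have mY : measurable Y.
      rewrite (_ : Y = (K : set (borelRd R d)) `&`
        ((fun y : borelRd R d => ((x : 'rV[R]_d) - y : borelRd R d)) @^-1` T)); last by [].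
      apply: measurableI => //.
      have msub : measurable_fun setT (fun y : borelRd R d => ((x : 'rV[R]_d) - y : borelRd R d)).
        apply: measurable_fun_borelRd => i.
        rewrite (_ : (fun _ => _) = (fun y => (x : 'rV[R]_d) ord0 i - (y : 'rV[R]_d) ord0 i)).
          by apply: measurable_funB => //; exact: measurable_coord_borelRd.
        by apply/funext => z; rewrite !mxE.
      by rewrite -[X in measurable X]setTI; exact: msub.
    have -> : lam Y = (\int[lam]_y (\1_Y y)%:E)%E by rewrite integral_indic// setIT.
    rewrite [leRHS]integral_mkcond.
    apply: le_integral_ge0 => [y _|y _]; first by rewrite lee_fin.
    rewrite indicE; have [Yy|nYy] := boolP (y \in Y); last by rewrite patchE; case: ifP.
    have [Ky Txy] : Y y by rewrite inE in Yy.
    rewrite patchE mem_set; last exact: KM.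
    have one r u : 1 <= u -> 0 <= r -> 1 <= u `^ r :> R.
      move=> u1 r0; rewrite (_ : 1 = 1 `^ r); last by rewrite powR1.
      by apply: ge0_ler_powR; rewrite ?nnegrE// (le_trans ler01).
    rewrite lee_fin; have r1 : 0 <= a by lra.
    have r2 : 0 <= 2 - 2 * a by lra.
    rewrite -[leLHS]mulr1; apply: ler_pM => //; last by apply: one => //; exact: bump_ge1.
    by rewrite -[leLHS]mulr1; apply: ler_pM => //; apply: one => //; exact: bump_ge1.
  have -> : (\int[lam]_(x in cube M) \int[lam]_(y in cube M) P x y =
      \int[lam]_(y in cube M) \int[lam]_(x in cube M) P x y)%E.
    exact: (@tonelli_rectangle _ _ _ _ R lam lam _ _ (fun z => P z.1 z.2)
      (mC M) (mC M) mP (fun z => P0 _ _)).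
  have := @young_space R a a1 a1' d lam M e (bump K n) (bump K n) (bump T n) h M0 e0.
  by apply; [exact: bump_lipschitz..| | |]; move=> x; exact: bump_ge.
have L0 : (0 <= L)%E by exact: integral_ge0.
have Lfin : L \is a fin_num.
  by rewrite ge0_fin_numE// (le_lt_trans (LB 0%N))// ltry.
have Icvg : I n @[n --> \oo] --> v.
  rewrite /v (_ : (K : set (borelRd R d)) = (K : set (borelRd R d)) `&` cube M).
    exact: integral_bump_cvg.
  by apply/esym/setIidPl.
have Jcvg : J n @[n --> \oo] --> w by exact: integral_bump_cvg.
rewrite -(fineK Lfin) lee_fin.
have Bcvg : B n @[n --> \oo] --> young_const a ^+ d * (v `^ a * v `^ a * w `^ (2 - 2 * a)).
  apply: cvgM; first exact: cvg_cst.
  have pcvg (u : nat -> R) (r x : R) : 0 < x -> u n @[n --> \oo] --> x ->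
      u n `^ r @[n --> \oo] --> x `^ r.
    move=> x0 ux; apply: (@continuous_cvg _ _ _ _ _ _ (fun y : R => y `^ r)) ux.
    exact: powR_continuous_at.
  apply: cvgM; last exact: pcvg.
  by apply: cvgM; exact: pcvg.
apply: (cvgr_to_ge Bcvg); apply: nearW => n.
by rewrite -lee_fin fineK//; exact: LB.
Qed.

(** * Sublevel sets of the gauge, and the distance distribution as an integral *)

Lemma gauge_le {R : realType} d (K : set 'rV[R]_d) (t : R) (z : 'rV[R]_d) :
  closed K -> convex_set K -> K° 0 -> 0 < t ->
  (gauge K z <= t) <-> K (t^-1 *: z).
Proof.
move=> cK vK K0 t0.
have [e /= e0 eK] : exists2 e : R, 0 < e & ball 0 e `<=` K.
  by move: K0 => /nbhs_ballP[e /= e0 eK]; exists e.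
pose S := [set l : R | 0 < l /\ exists2 k, K k & z = l *: k].
have lbS : has_lbound S by exists 0 => l [/ltW].
have KK0 : K 0 by apply: eK; exact: ballxx.
(* Convexity and 0 in [K] make [K] star-shaped about the origin. *)
have shrink k r : K k -> 0 <= r -> r <= 1 -> K (r *: k).
  move=> Kk r0 r1; have := vK k 0 (Itv01 r0 r1).
  rewrite !inE => /(_ Kk KK0).
  by rewrite /conv/= scaler0 addr0.
(* Without this the infimum would be a default value. [N] exceeds every coordinate of [z] in
   absolute value, so division by [2 * N / e] brings [z] into the ball of radius [e], which lies in
   [K]. *)
have neS : S !=set0.
  pose N := \sum_i `|z ord0 i| + 1.
  have N0 : 0 < N by rewrite ltr_wpDl// sumr_ge0.
  have l0 : 0 < 2 * N / e by rewrite divr_gt0// mulr_gt0.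
  exists (2 * N / e); split => //; exists ((2 * N / e)^-1 *: z); last first.
    by rewrite scalerA divff ?scale1r// gt_eqF.
  apply: eK; split => // i j; rewrite ord1 /ball/= !mxE sub0r normrN normrM gtr0_norm ?invr_gt0//.
  rewrite ltr_pdivrMl//.
  have zN : `|z ord0 j| < N.
    by rewrite /N (bigD1 j)//= -addrA ltrDl ltr_wpDl// sumr_ge0.
  by rewrite divfK ?gt_eqF//; lra.
split=> [gt|Kz]; last first.
  apply: ge_inf => //; split => //; exists (t^-1 *: z) => //.
  by rewrite scalerA divff ?scale1r// gt_eqF.
have big s : t < s -> K (s^-1 *: z).
  move=> ts; have [l [l0 [k Kk zE]] ls] := inf_lt neS (le_lt_trans gt ts).
  have s0 : 0 < s by exact: lt_trans ts.
  rewrite zE scalerA; apply: shrink => //.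
    by rewrite mulr_ge0// ?invr_ge0 ltW.
  by rewrite ler_pdivrMl// mulr1 ltW.
(* The infimum gives membership for every [s > t]; closedness of [K] gives it at [t], as [s]
   decreases to [t]. *)
apply: (@closed_cvg _ _ t^'+ _ (fun s => s^-1 *: z) K cK).
  by near=> s; apply: big; near: s; exact: nbhs_right_gt.
apply: cvgZ; last exact: cvg_cst.
by apply: cvg_at_right_filter; apply: cvgV; [rewrite gt_eqF|exact: cvg_id].
Unshelve. all: by end_near. Qed.

Lemma lebesgue_cube_gt0 {R : realType} d
    (lam : {measure set (borelRd R d) -> \bar R}) (r : R) :
  is_lebesgue_measure lam -> 0 < r -> (0 < lam (cube r))%E.
Proof.
move=> h r0; rewrite /cube /cbox h; last by move=> i; rewrite !mxE; lra.
by rewrite lte_fin; apply: prodr_gt0 => i _; rewrite !mxE; lra.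
Qed.

Lemma cube_sub_ball {R : realType} d (e r : R) : 0 < e -> r < e ->
  (cube r : set (borelRd R d)) `<=` (ball (0 : 'rV[R]_d) e).
Proof.
move=> e0 re x /cubeP xr; split => // i j.
by rewrite ord1 /ball/= mxE sub0r normrN (le_lt_trans (xr j)).
Qed.

Lemma bounded_sub_cube {R : realType} d (K : set 'rV[R]_d) : bounded_set K ->
  exists2 M : R, 0 < M & (K : set (borelRd R d)) `<=` cube M.
Proof.
move=> /ex_strict_bound_gt0[M M0 KM]; exists M => // x Kx; apply/cubeP => i.
apply: le_trans (ltW (KM x Kx)).
have /mapP[j Hj ->] : `|(x : 'rV[R]_d) ord0 i| \in
    [seq `|(x : 'rV[R]_d) p.1 p.2| | p : 'I_1 * 'I_d].
  by apply/mapP; exists (ord0, i) => //=; rewrite mem_enum.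
by rewrite [leRHS]/Num.norm /= mx_normrE; apply/bigmax_geP; right => /=; exists j.
Qed.

(** [uniform_on] is a bare set function; it is recognized as the restriction of [lam] to [K] scaled
    by [v^-1], a genuine measure. The two factors of the product measure contribute one [v^-1]
    each. *)
Lemma Fdist_integral {R : realType} d (K : set 'rV[R]_d)
    (lam : {sigma_finite_measure set (borelRd R d) -> \bar R}) (t : R) :
  (0 < lam (K : set (borelRd R d)) < +oo)%E ->
  closed K -> convex_set K -> K° 0 -> 0 < t ->
  let v := fine (lam (K : set (borelRd R d))) in
  (Fdist lam K t =
   (v^-1)%:E * ((v^-1)%:E * \int[lam]_(x in K)
     lam [set y : borelRd R d | K y /\ K (t^-1 *: ((x : 'rV[R]_d) - y))%R]))%E.
Proof.
move=> /andP[lK lKy] cK vK K0 t0 v.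
have mK : measurable (K : set (borelRd R d)) by exact: closed_measurable_borelRd.
have v0 : 0 < v by rewrite fine_gt0// lK.
have k0 : 0 <= v^-1 by rewrite invr_ge0 ltW.
have vE : lam (K : set (borelRd R d)) = v%:E.
  by rewrite fineK// ge0_fin_numE// ltW.
pose m := mscale (NngNum k0) (mrestr lam mK).
have mE : uniform_on lam K = m.
  apply/funext => A; rewrite /uniform_on /m /mscale /mrestr/= vE.
  by rewrite muleC inver gt_eqF.
pose T := [set p : borelRd R d * borelRd R d |
  [/\ K p.1, K p.2 & K (t^-1 *: ((p.1 : 'rV[R]_d) - p.2))]].
have -> : Fdist lam K t = (\int[m]_x m (xsection T x))%E.
  rewrite /Fdist /product_measure1 mE; congr (integral _ _ _).
  apply/funext => x /=; congr (m _); apply/seteqP; split => y /=;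
    rewrite /xsection/= !inE => -[/= Kx Ky xy]; split => //.
    exact: (gauge_le _ cK vK K0 t0).1.
  exact: (gauge_le _ cK vK K0 t0).2.
have mT : measurable T.
  pose sub (p : borelRd R d * borelRd R d) : borelRd R d :=
    t^-1 *: ((p.1 : 'rV[R]_d) - p.2).
  have msub : measurable_fun setT sub.
    apply: measurable_fun_borelRd => i.
    rewrite (_ : (fun _ => _) = (fun p : borelRd R d * borelRd R d =>
        t^-1 * ((p.1 : 'rV[R]_d) ord0 i - (p.2 : 'rV[R]_d) ord0 i))).
      apply: measurable_funM => //; apply: measurable_funB.
        by apply: (measurableT_comp (measurable_coord_borelRd i)).
      by apply: (measurableT_comp (measurable_coord_borelRd i)).
    by apply/funext => p; rewrite !mxE.
  rewrite (_ : T = fst @^-1` (K : set (borelRd R d)) `&`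
     (snd @^-1` (K : set (borelRd R d)) `&` sub @^-1` K)); last first.
    by apply/seteqP; split => p /=; [move=> [? ? ?]|move=> [? [? ?]]].
  apply: measurableI; [|apply: measurableI]; rewrite -[X in measurable X]setTI.
  - exact: measurable_fst.
  - exact: measurable_snd.
  - exact: msub.
have TE x : K x -> xsection T x =
    [set y : borelRd R d | K y /\ K (t^-1 *: ((x : 'rV[R]_d) - y))].
  move=> Kx; apply/seteqP; split => y; rewrite /xsection/= inE; first by case.
  by case.
have mg := measurable_fun_xsection lam mT.
have mxE x : m (xsection T x) = ((v^-1)%:E * lam (xsection T x))%E.
  rewrite /m /mscale/= /mrestr; congr (_ * lam _)%E.
  by apply/setIidPl => y; rewrite /xsection/= inE => -[].
have out x : ~ K x -> lam (xsection T x) = 0%E.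
  move=> nKx; rewrite (_ : xsection T x = set0) ?measure0//.
  by apply/seteqP; split => // y; rewrite /xsection/= inE => -[].
transitivity (\int[m]_(x in K) ((v^-1)%:E * lam (xsection T x)))%E.
  rewrite [RHS]integral_mkcond; apply: eq_integral => x _.
  rewrite patchE; case: ifPn => [_|]; first exact: mxE.
  by move=> xK; rewrite mxE out ?mule0//; apply: contraNnot xK => ?; rewrite inE.
(* On subsets of [K] the restriction to [K] changes nothing. *)
rewrite (eq_measure_integral (mscale (NngNum k0) lam)); last first.
  by move=> A mA AK; rewrite /m /mscale/= /mrestr; congr (_ * lam _)%E; exact/setIidPl.
rewrite ge0_integral_mscale//; last 2 first.
- by apply: measurable_funTS; apply: measurable_funeM; exact: mg.
- by move=> x _; rewrite mule_ge0.
congr (_ * _)%E; rewrite ge0_integralZl_EFin//; last first.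
  by apply: measurable_funTS; exact: mg.
congr (_ * _)%E; apply: eq_integral => x xK.
by rewrite TE//; rewrite inE in xK.
Qed.

Theorem theorem24 (R : realType) (d : nat) (K : set 'rV[R]_d)
    (lam : {measure set (borelRd R d) -> \bar R}) (t : R) :
  is_lebesgue_measure lam ->
  convex_body K -> K° 0 ->
  0 < t -> t < Num.sqrt 2 ->
  (Fdist lam K t <= ((t ^+ 2 * (4 - t ^+ 2) / 4) `^ (d%:R / 2))%:E)%E.
Proof.
move=> h [kK vK _] K0 t0 t2.
have [l lE] := lebesgue_sigma_finite h.
have {}h : is_lebesgue_measure l by rewrite lE.
rewrite -lE.
have cK : closed K by apply: compact_closed kK; exact: norm_hausdorff.
have [M M0 KM] := bounded_sub_cube (compact_bounded kK).
have [e /= e0 eK] : exists2 e : R, 0 < e & ball 0 e `<=` K.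
  by move: K0 => /nbhs_ballP[e /= e0 eK]; exists e.
(* A cube inside [K] gives [K] positive volume. *)
have rK : (cube (e / 2) : set (borelRd R d)) `<=` K.
  by apply: subset_trans (cube_sub_ball e0 _) eK; lra.
have KK0 : K 0 by apply: eK; exact: ballxx.
have mK : measurable (K : set (borelRd R d)) by exact: closed_measurable_borelRd.
(* The dilate tK, written as a preimage so that closedness and the scaling of volume apply
   directly. *)
pose T : set 'rV[R]_d := (fun x => t^-1 *: x) @^-1` K.
have cT : closed T.
  apply: preimage_closed cK => x _.
  by apply: (@cvgZ _ _ _ (nbhs x) _ (cst t^-1) id); [exact: cvg_cst|exact: cvg_id].
have mT : measurable (T : set (borelRd R d)) by exact: closed_measurable_borelRd.
have lK : (0 < l (K : set (borelRd R d)))%E.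
  apply: (lt_le_trans (lebesgue_cube_gt0 h (_ : 0 < e / 2))); first lra.
  by apply: le_measure => //; rewrite inE//; exact: measurable_cube.
have lKy : (l (K : set (borelRd R d)) < +oo)%E.
  apply: le_lt_trans (lebesgue_cube_lty M h).
  by apply: le_measure => //; rewrite inE//; exact: measurable_cube.
have mC (N : R) : measurable (cube N : set (borelRd R d)) by exact: measurable_cube.
have lT : (0 < l ((T : set (borelRd R d)) `&` cube (2 * M)))%E.
  (* The first bound puts the cube inside tK, since [cube (e / 2)] lies in [K]; the second keeps it
     inside [cube (2 * M)]. *)
  pose r := Num.min (t * (e / 2)) (2 * M).
  have r0 : 0 < r by rewrite lt_min !mulr_gt0.
  apply: (lt_le_trans (lebesgue_cube_gt0 h r0)).
  apply: le_measure; rewrite ?inE//; first exact: measurableI.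
  move=> x /cubeP xr; split.
    apply: rK; apply/cubeP => i; rewrite mxE normrM gtr0_norm ?invr_gt0//.
    by rewrite ler_pdivrMl// (le_trans (xr i))// ge_min lexx.
  by apply/cubeP => i; rewrite (le_trans (xr i))// ge_min lexx orbT.
pose a := (1 + t ^+ 2 / (4 - t ^+ 2)) / 2.
have [a1 a1' aE] := young_const_expr t0 t2; rewrite -/a in a1 a1' aE.
rewrite Fdist_integral ?lK//.
have T0 : T !=set0 by exists 0; rewrite /T/= scaler0.
have := @pair_volume_le R d l a M K T a1 a1' M0 h cK (ex_intro _ 0 KK0) cT T0 KM lK lT.
set v := fine (l K); set w := fine _ => PV.
have v0 : 0 < v by rewrite fine_gt0// lK.
have vE : l (K : set (borelRd R d)) = v%:E.
  by rewrite fineK// ge0_fin_numE// ltW.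
(* Dropping the intersection with the cube leaves |tK| = t^d |K|; the exponent [2 - 2 * a] is
   nonnegative, so this bound can be inserted into the power. *)
have wv : w <= t ^+ d * v.
  have : (l ((T : set (borelRd R d)) `&` cube (2 * M)) <= (t ^+ d * v)%:E)%E.
    rewrite EFinM -vE -(lebesgue_scale h t0 mK).
    by apply: le_measure; rewrite ?inE//; exact: measurableI.
  by move=> lw; rewrite -lee_fin /w fineK// ge0_fin_numE// (le_lt_trans lw)// ltry.
have w0 : 0 <= w by exact: fine_ge0.
have C0 : 0 <= young_const a.
  by rewrite /young_const !mulr_ge0 ?powR_ge0 ?sqrtr_ge0.
have c0 : 0 <= 2 - 2 * a by lra.
have vV : 0 <= v^-1 by rewrite invr_ge0 ltW.
have td : 0 <= t ^+ d by rewrite exprn_ge0// ltW.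
apply: (@le_trans _ _ ((v^-1)%:E * ((v^-1)%:E * (young_const a ^+ d *
    (v `^ a * v `^ a * (t ^+ d * v) `^ (2 - 2 * a)))%:E))%E).
  do 2!(apply: lee_wpmul2l; first by rewrite lee_fin).
  apply: (le_trans PV); rewrite lee_fin.
  rewrite ler_wpM2l ?exprn_ge0// ler_wpM2l ?mulr_ge0 ?powR_ge0//.
  by apply: ge0_ler_powR; rewrite ?nnegrE// mulr_ge0// ltW.
rewrite -!EFinM lee_fin le_eqVlt; apply/orP; left; apply/eqP.
rewrite powRM// ?(ltW v0)//.
(* The exponents add up to 2, so the volume of [K] cancels against the two normalizations. *)
have vv : v `^ a * v `^ a * v `^ (2 - 2 * a) = v * v.
  rewrite -!powRD; try by apply/implyP => _; rewrite gt_eqF.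
  rewrite (_ : a + a + (2 - 2 * a) = 2%:R); last by ring.
  by rewrite powR_mulrn ?expr2// ltW.
have tt : (t ^+ d) `^ (2 - 2 * a) = (t `^ (2 - 2 * a)) ^+ d.
  by rewrite -powR_mulrn ?(ltW t0)// powRAC powR_mulrn// powR_ge0.
set X := (X in X `^ (d%:R / 2)).
have X0 : 0 <= X.
  have tt2 : t ^+ 2 < 2.
    by rewrite -[ltRHS](@sqr_sqrtr R 2)// !expr2 ltr_pM// ltW.
  by rewrite /X divr_ge0// mulr_ge0 ?sqr_ge0//; lra.
have -> : X `^ (d%:R / 2) = Num.sqrt X ^+ d.
  by rewrite mulrC powRrM powR12_sqrt// powR_mulrn// sqrtr_ge0.
rewrite -aE [RHS]exprMn tt.
rewrite [LHS](_ : _ = v^-1 * v^-1 * (v `^ a * v `^ a * v `^ (2 - 2 * a)) *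
  (young_const a ^+ d * (t `^ (2 - 2 * a)) ^+ d)); last by ring.
rewrite vv (_ : v^-1 * v^-1 * (v * v) = 1) ?mul1r//.
by field; rewrite gt_eqF.
Qed.
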